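(* Let $\mu$ and $\nu$ be strict partitions, and let $x=(x_1,x_2,\dots)$, $y=(y_1,y_2,\dots)$ be two sets of commuting variables. Then \[ \sum_\lambda GP_{\lambda/\!\!/\mu}(x)\,gq_{\lambda/\nu}(y)=\prod_{i,j\ge1}\frac{1-\overline{x_i}y_j}{1-x_iy_j}\sum_\kappa GP_{\nu/\!\!/\kappa}(x)\,gq_{\mu/\kappa}(y) \] and \[ \sum_\lambda GQ_{\lambda/\!\!/\mu}(x)\,gp_{\lambda/\nu}(y)=\prod_{i,j\ge1}\frac{1-\overline{x_i}y_j}{1-x_iy_j}\sum_\kappa GQ_{\nu/\!\!/\kappa}(x)\,gp_{\mu/\kappa}(y), \] where $\overline{x_i}:=\frac{-x_i}{1+\beta x_i}$ and $\lambda,\kappa$ range over all strict partitions.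
   Context: A strict partition is a finite strictly decreasing sequence of positive integers (possibly empty); $|\lambda|=\sum\lambda_i$. $\mathsf{SD}_\lambda=\{(i,j)\in\mathbb{Z}^2:0<i\le j<i+\lambda_i\}$; $\mu\subseteq\lambda$ means $\mu_i\le\lambda_i$ for all $i$, $\mathsf{SD}_{\lambda/\mu}=\mathsf{SD}_\lambda\setminus\mathsf{SD}_\mu$, $|\lambda/\mu|=|\mathsf{SD}_{\lambda/\mu}|$. Let $i'=i-\frac12$ ($1'<1<2'<2<\cdots$). A semistandard set-valued shifted tableau of shape $\lambda/\mu$ is a filling $T$ of $\mathsf{SD}_{\lambda/\mu}$ by nonempty finite sets of positive half-integers, weakly increasing along rows and columns ($S\le S'$ iff $\max S\le\min S'$), with no unprimed number in two boxes of one column and no primed number in two boxes of one row; $\mathrm{SetShYT}_Q(\lambda/\mu)$ is the set of these, $\mathrm{SetShYT}_P(\lambda/\mu)$ those with no primed number in a diagonal box $(j,j)$. $x^T=\prod x_i^{m_i}$ ($m_i$ = total occurrences of $i$ or $i'$), $|T|$ = total number of elements. $GP_{\lambda/\mu}=\sum_{T\in\mathrm{SetShYT}_P(\lambda/\mu)}\beta^{|T|-|\lambda/\mu|}x^T$, $GQ_{\lambda/\mu}$ likewise over $\mathrm{SetShYT}_Q$; both are $0$ if $\mu\not\subseteq\lambda$; $GP_\lambda=GP_{\lambda/\emptyset}$, $GQ_\lambda=GQ_{\lambda/\emptyset}$. $\mathsf{Rem}(\mu)$ is the set of boxes $b\in\mathsf{SD}_\mu$ with $\mathsf{SD}_\mu\setminus\{b\}$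 a shifted diagram of a strict partition; $GP_{\lambda/\!\!/\mu}=\sum_\nu\beta^{|\mu/\nu|}GP_{\lambda/\nu}$, $GQ_{\lambda/\!\!/\mu}=\sum_\nu\beta^{|\mu/\nu|}GQ_{\lambda/\nu}$ over strict $\nu\subseteq\mu$ with $\mathsf{SD}_{\mu/\nu}\subseteq\mathsf{Rem}(\mu)$, and both are $0$ if $\mu\not\subseteq\lambda$. The dual functions $gp_\lambda,gq_\lambda\in\mathbb{Z}[\beta][[x_1,x_2,\dots]]$ are the unique elements with $\sum_\lambda GQ_\lambda(x)gp_\lambda(y)=\sum_\lambda GP_\lambda(x)gq_\lambda(y)=\prod_{i,j}\frac{1-\overline{x_i}y_j}{1-x_iy_j}$. There are unique integers $a^\lambda_{\mu\nu},b^\lambda_{\mu\nu}$ with $GP_\mu GP_\nu=\sum_\lambda a^\lambda_{\mu\nu}\beta^{|\lambda|-|\mu|-|\nu|}GP_\lambda$ and $GQ_\mu GQ_\nu=\sum_\lambda b^\lambda_{\mu\nu}\beta^{|\lambda|-|\mu|-|\nu|}GQ_\lambda$; $gq_{\lambda/\mu}:=\sum_\nu a^\lambda_{\mu\nu}\beta^{|\lambda|-|\mu|-|\nu|}gq_\nu$, $gp_{\lambda/\mu}:=\sum_\nu b^\lambda_{\mu\nu}\beta^{|\lambda|-|\mu|-|\nu|}gp_\nu$. *)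

(* Defs.v *)
From HB Require Import structures.
From mathcomp Require Import all_boot all_order all_algebra.
From mathcomp Require Import finmap multiset.
From mathcomp Require Import boolp classical_sets functions cardinality fsbigop.

Set Implicit Arguments.
Unset Strict Implicit.
Unset Printing Implicit Defensive.

Import GRing.Theory.

Local Open Scope classical_set_scope.
Local Open Scope fset_scope.
Local Open Scope ring_scope.

Notation monom I := (multiset_of (Phant I)).

(* A series is the family of its coefficients, indexed by the monomials
   in the variables I, i.e. by the finite multisets of elements of I. *)
Definition fps (R : comNzRingType) (I : choiceType) := monom I -> R.

Definition msplit (I : choiceType) (m : monom I) : set (monom I * monom I) :=
  [set p | (p.1 `+` p.2)%mset = m].

HB.lock Definition fps_const (R : comNzRingType) (I : choiceType) (c : R) : fps R I :=
  fun m => if m == mset0 then c else 0.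

HB.lock Definition fps_var (R : comNzRingType) (I : choiceType) (i : I) : fps R I :=
  fun m => (m == [mset i]%mset)%:R.

HB.lock Definition fps_mul (R : comNzRingType) (I : choiceType) (f g : fps R I) :
  fps R I := fun m => \sum_(p \in msplit m) f p.1 * g p.2.

Section FpsRing.
Variables (R : comNzRingType) (I : choiceType).
Implicit Types (f g h : fps R I) (m : monom I).

HB.instance Definition _ := GRing.Zmodule.copy (fps R I) (monom I -> R).

Let divs m : {fset monom I} := fset_set [set a | (a `<=` m)%mset].

Let finite_divs m : finite_set [set a : monom I | (a `<=` m)%mset].
Proof.
pose n := (size m).+1.
pose F (t : {ffun finsupp m -> 'I_n}) : monom I :=
  [fsfun x : finsupp m => nat_of_ord (t x) | 0%N].
apply: (@sub_finite_set _ _ (F @` [set: {ffun finsupp m -> 'I_n}])); last first.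
  exact/finite_image/finite_finset.
move=> a /= /msubsetP am.
have lt x : (a x < n)%N.
  rewrite ltnS (leq_trans (am x))// -count_mem_mset.
  exact: count_size.
exists [ffun x => Ordinal (lt (val x))] => //.
apply/fsfunP => x; rewrite /F fsfun_ffun.
case: insubP => [u _ <-|xm] /=; first by rewrite ffunE.
by apply/esym/eqP; rewrite -leqn0 (leq_trans (am x)) // fsfun_dflt.
Qed.

Let in_divs m a : (a \in divs m) = (a `<=` m)%mset.
Proof. by rewrite /divs in_fset_set//; apply/idP/idP => /[!inE]. Qed.

Let divs_l a b : a \in divs (a `+` b)%mset.
Proof. by rewrite in_divs; apply/msubsetP => x; rewrite msetE2 leq_addr. Qed.

Let divs_r a b : b \in divs (a `+` b)%mset.
Proof. by rewrite in_divs; apply/msubsetP => x; rewrite msetE2 leq_addl. Qed.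

Let fps_mulE f g m (V : {fset monom I}) : {subset divs m <= V} ->
  fps_mul f g m =
  \sum_(a <- V) \sum_(b <- V) (if (a `+` b)%mset == m then f a * g b else 0).
Proof.
move=> sV; rewrite [fps_mul]unlock.
pose F a b : R := if (a `+` b)%mset == m then f a * g b else 0.
have -> : \sum_(p \in msplit m) f p.1 * g p.2 = \sum_(p \in msplit m) F p.1 p.2.
  by apply: eq_fsbigr => p; rewrite inE /msplit /= /F => ->; rewrite eqxx.
have -> : \sum_(a <- V) \sum_(b <- V) F a b =
    \sum_(a \in [set` V]) \sum_(b \in [set` V]) F a b.
  rewrite [LHS]fsbig_seq ?fset_uniq//; apply: eq_fsbigr => a _.
  by rewrite fsbig_seq ?fset_uniq.
have Vfin : finite_set [set` V] by exact: finite_fset.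
rewrite (pair_fsbig _ _ Vfin Vfin).
apply: fsbig_widen => [[p q] /= pm|p [_ /= /eqP/negbTE pm]]; last by rewrite /F pm.
have Vp : p \in V by apply: sV; rewrite -pm; exact: divs_l.
have Vq : q \in V by apply: sV; rewrite -pm; exact: divs_r.
by split.
Qed.

Let fps_mulC : commutative (@fps_mul R I).
Proof.
move=> f g; apply/funext => m.
rewrite !(@fps_mulE _ _ _ (divs m))// exchange_big/=.
by apply: eq_bigr => a _; apply: eq_bigr => b _; rewrite msetDC mulrC.
Qed.

Let fps_mulDl : left_distributive (@fps_mul R I) +%R.
Proof.
move=> f g h; apply/funext => m; rewrite !fctE !(@fps_mulE _ _ _ (divs m))//.
rewrite -big_split/=; apply: eq_bigr => a _; rewrite -big_split/=.
by apply: eq_bigr => b _; case: ifP => _; rewrite ?addr0 // mulrDl.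
Qed.

Let sum_delta (V : {fset monom I}) (c : monom I) (F : monom I -> R) :
  (c \notin V -> F c = 0) ->
  \sum_(a <- V) (if c == a then F a else 0) = F c.
Proof.
move=> Vc; have [cV|cV] := boolP (c \in V).
  rewrite (big_fsetD1 c)//= eqxx big_seq big1 ?addr0// => a.
  by rewrite !inE eq_sym => /andP[/negbTE ->].
rewrite Vc// big_seq big1// => a aV; case: eqP => // ca.
by rewrite ca aV in cV.
Qed.

Let fps_mul1 : left_id (@fps_const R I 1) (@fps_mul R I).
Proof.
move=> f; apply/funext => m; rewrite (@fps_mulE _ _ _ (divs m))//.
rewrite (eq_bigr (fun a : monom I => if mset0 == a then f m else 0)); last first.
  move=> a _; rewrite [fps_const]unlock eq_sym; case: eqP => [<-|_]; last first.
    by apply: big1 => b _; rewrite mul0r if_same.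
  rewrite -[RHS](@sum_delta (divs m)).
    by apply: eq_bigr => b _; rewrite mset0D eq_sym mul1r.
  by rewrite in_divs msubset_refl.
by apply: (@sum_delta (divs m) mset0 (fun=> f m)); rewrite in_divs msub0set.
Qed.

Let fps_mulA : associative (@fps_mul R I).
Proof.
suff H f g h m : fps_mul f (fps_mul g h) m = \sum_(a <- divs m)
    \sum_(b <- divs m) \sum_(d <- divs m)
      (if (a `+` (b `+` d))%mset == m then f a * (g b * h d) else 0).
  move=> f g h; apply/funext => m; rewrite [fps_mul (fps_mul f g) h]fps_mulC !H.
  rewrite [RHS]exchange_big; apply: eq_bigr => a _.
  rewrite [RHS]exchange_big; apply: eq_bigr => b _; apply: eq_bigr => d _ /=.
  by rewrite [(d `+` _)%mset]msetDC -msetDA mulrA [_ * h d]mulrC.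
rewrite (@fps_mulE _ _ _ (divs m))//; apply: eq_bigr => a _.
transitivity (\sum_(c <- divs m) \sum_(b <- divs m) \sum_(d <- divs m)
   (if (b `+` d)%mset == c then
      if (a `+` c)%mset == m then f a * (g b * h d) else 0 else 0)).
  rewrite big_seq [RHS]big_seq; apply: eq_bigr => c cm.
  rewrite (@fps_mulE _ _ _ (divs m)); last first.
    by move=> x; rewrite !in_divs in cm * => /msubset_trans; apply.
  case: ifP => _; last by rewrite big1// => b _; rewrite big1// => d _; rewrite if_same.
  rewrite mulr_sumr; apply: eq_bigr => b _; rewrite mulr_sumr; apply: eq_bigr => d _.
  by case: ifP; rewrite ?mulr0.
rewrite exchange_big; apply: eq_bigr => b _; rewrite exchange_big.
apply: eq_bigr => d _ /=.
rewrite (@sum_delta _ _ (fun c => if (a `+` c)%mset == m then f a * (g b * h d) else 0))//.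
by case: eqP => // <-; rewrite divs_r.
Qed.

Let fps_1neq0 : @fps_const R I 1 != 0.
Proof.
by apply/eqP => /(congr1 (@^~ mset0)); rewrite [fps_const]unlock eqxx => /eqP; rewrite oner_eq0.
Qed.

HB.instance Definition _ := GRing.Zmodule_isComNzRing.Build (fps R I)
  fps_mulA fps_mulC fps_mul1 fps_mulDl fps_1neq0.

End FpsRing.

(* Units and inverses, classically: f^-1 is the inverse of f if there is one,
   and f itself otherwise. *)
HB.lock Definition fps_unit (R : comNzRingType) (I : choiceType) (f : fps R I) : bool :=
  `[< exists g, g * f = 1 >].

HB.lock Definition fps_inv (R : comNzRingType) (I : choiceType) (f : fps R I) : fps R I :=
  if pselect (exists g, g * f = 1) is left e then projT1 (cid e) else f.

Section FpsUnitRing.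
Variables (R : comNzRingType) (I : choiceType).
Implicit Types (f g : fps R I) (m : monom I).

Let fps_mulV : {in @fps_unit R I, left_inverse 1 (@fps_inv R I) *%R}.
Proof.
move=> f; rewrite unfold_in unlock => /asboolP e.
rewrite [fps_inv]unlock; case: pselect => // e'.
exact: (projT2 (cid e')).
Qed.

Let fps_unitP f g : g * f = 1 -> fps_unit f.
Proof. by move=> gf; rewrite unlock; apply/asboolP; exists g. Qed.

Let fps_invout : {in [predC @fps_unit R I], @fps_inv R I =1 id}.
Proof.
move=> f; rewrite inE/= unfold_in [fps_unit]unlock [fps_inv]unlock => /negP nf.
by case: pselect => // e; case: nf; apply/asboolP.
Qed.

HB.instance Definition _ := GRing.ComNzRing_hasMulInverse.Build (fps R I)
  fps_mulV fps_unitP fps_invout.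

End FpsUnitRing.

Section FpsUnit.
Variables (R : comNzRingType) (I : choiceType).
Implicit Types (f g u : fps R I) (m : monom I).

Lemma coef_fps1 m : (1 : fps R I) m = (m == mset0)%:R.
Proof. by have -> : 1 = @fps_const R I 1 by []; rewrite unlock; case: eqP. Qed.

Lemma coef_fpsD f g m : (f + g) m = f m + g m.
Proof. by []. Qed.

Lemma coef_fpsN f m : (- f) m = - f m.
Proof. by []. Qed.

Lemma coef_fpsM f g m : (f * g) m = \sum_(p \in msplit m) f p.1 * g p.2.
Proof. by have -> : f * g = fps_mul f g by []; rewrite unlock. Qed.

Let size_msetD (a b : monom I) : size (a `+` b)%mset = (size a + size b)%N.
Proof.
have -> : (a `+` b)%mset = seq_mset (a ++ b).
  by apply/msetP => x; rewrite mset_seqE count_cat !count_mem_mset msetE2.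
by rewrite (perm_size (perm_eq_seq_mset _)) size_cat.
Qed.

Let coefX_small u k m : u mset0 = 0 -> (size m < k)%N -> (u ^+ k) m = 0.
Proof.
move=> u0; elim: k m => // k IH m mk; rewrite exprS coef_fpsM fsbig1// => p pm.
have [->|p0] := eqVneq p.1 mset0; first by rewrite u0 mul0r.
rewrite IH ?mulr0//; rewrite -pm size_msetD ltnS in mk.
by apply: leq_trans mk; rewrite -[ltnLHS]add0n ltn_add2r lt0n size_mset_eq0.
Qed.

Lemma fps_unit_coef0 f : f mset0 = 1 -> f \is a GRing.unit.
Proof.
move=> f0; pose u := 1 - f.
have u0 : u mset0 = 0.
  by rewrite /u coef_fpsD coef_fpsN coef_fps1 f0 eqxx subrr.
pose g : fps R I := fun m => (\sum_(k < (size m).+1) u ^+ k) m.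
have sumE (r : seq nat) m : (\sum_(k <- r) u ^+ k) m = \sum_(k <- r) (u ^+ k) m.
  by elim: r => [|k r IH]; rewrite ?big_nil// !big_cons coef_fpsD IH.
have gE m n : (size m <= n)%N -> g m = (\sum_(k < n.+1) u ^+ k) m.
  move=> mn; rewrite /g -!(big_mkord xpredT (fun k => u ^+ k)) !sumE.
  rewrite [in RHS](big_cat_nat _ (n := (size m).+1))//= [X in _ + X]big_nat_cond.
  by rewrite [X in _ + X]big1 ?addr0// => k /andP[/andP[mk _] _]; exact: coefX_small.
apply/unitrPr; exists g; apply/funext => m.
have -> : (f * g) m = (f * \sum_(k < (size m).+1) u ^+ k) m.
  rewrite !coef_fpsM; apply: eq_fsbigr => p; rewrite inE => pm.
  by rewrite -(@gE p.2)// -pm size_msetD leq_addl.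
have -> : f = 1 - u by rewrite /u opprB addrC subrK.
have := subrX1 u (size m).+1; rewrite -opprB -[u - 1]opprB mulNr => /oppr_inj <-.
by rewrite coef_fpsD coef_fpsN coefX_small ?subr0.
Qed.

End FpsUnit.

Section FpsLimits.
Variables (R : comNzRingType) (I : choiceType).

Definition fps_summable (J : choiceType) (A : set J) (F : J -> fps R I) :=
  forall m, finite_set [set j | A j /\ F j m != 0].

(* Only meaningful when the family is summable. *)
Definition fps_sum (J : choiceType) (A : set J) (F : J -> fps R I) : fps R I :=
  fun m => \sum_(j \in A) F j m.

(* Coefficientwise limit: each coefficient is eventually constant. *)
Definition fps_lim (u : nat -> fps R I) : fps R I :=
  fun m => xget 0 [set c | exists N, forall n, (N <= n)%N -> u n m = c].

(* Substitution of the variable h i for each variable i, for injective h. *)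
Definition fps_rename (J : choiceType) (h : I -> J) (f : fps R I) : fps R J :=
  fun m => \sum_(n \in [set n : monom I | seq_mset [seq h i | i <- n] = m]) f n.

End FpsLimits.

Record spart := Spart { parts : seq nat; _ : sorted gtn parts && (0 \notin parts)%N }.

HB.instance Definition _ := [isSub for parts].
HB.instance Definition _ := [Choice of spart by <:].

Definition spart0 : spart := @Spart [::] isT.

Definition psize (lam : spart) : nat := sumn (parts lam).

(* Parts are numbered from 1; the value at i = 0 is junk, equal to that at 1. *)
Definition part (lam : spart) (i : nat) : nat := nth 0%N (parts lam) i.-1.

Definition SD (lam : spart) : {fset nat * nat} :=
  [fset p in [seq (i, j) | i <- iota 1 (size (parts lam)), j <- iota i (part lam i)]].

Lemma in_SD lam i j : ((i, j) \in SD lam) = (0 < i <= j)%N && (j < i + part lam i)%N.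
Proof.
rewrite !inE /=; apply/allpairsPdep/idP => [[i' [j' [+ + [-> ->]]]]|].
  by rewrite !mem_iota => /andP[-> _].
case/andP => /andP[i0 ij] ji; exists i, j; rewrite !mem_iota i0 ij ji; split=> //.
rewrite add1n ltnS /=; case: leqP => // il; move: ji.
by rewrite /part nth_default ?addn0 ?ltnNge ?ij// -ltnS prednK.
Qed.

Definition psub (mu lam : spart) : Prop := forall i, (part mu i <= part lam i)%N.

Definition skewSD (lam mu : spart) : {fset nat * nat} := SD lam `\` SD mu.

Definition removable (mu : spart) (b : nat * nat) : Prop :=
  b \in SD mu /\ exists nu : spart, SD nu = SD mu `\ b.

(* The natural number k stands for the half-integer (k + 1) / 2, so that
   0, 1, 2, 3, ... are 1' < 1 < 2' < 2 < ...; the variables are numbered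
   from 0, so that k contributes the variable of index k./2. *)
Definition primed (k : nat) : bool := ~~ odd k.

Definition filling (lam mu : spart) := {ffun skewSD lam mu -> {fset nat}}.

Section Tableaux.
Variables lam mu : spart.
Implicit Types (T : filling lam mu) (b c : skewSD lam mu).

Definition row b : nat := (val b).1.
Definition col b : nat := (val b).2.

(* max S <= min S', for nonempty S and S' *)
Definition set_le (S S' : {fset nat}) : Prop :=
  forall k l, k \in S -> l \in S' -> (k <= l)%N.

Definition SetShYT_Q : set (filling lam mu) := [set T | [/\
  forall b, T b != fset0,
  forall b c, row b = row c -> (col b < col c)%N -> set_le (T b) (T c),
  forall b c, col b = col c -> (row b < row c)%N -> set_le (T b) (T c),
  forall b c k, b != c -> col b = col c -> k \in T b -> k \in T c -> primed k &
  forall b c k, b != c -> row b = row c -> k \in T b -> k \in T c -> ~~ primed k]].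

Definition SetShYT_P : set (filling lam mu) := [set T | SetShYT_Q T /\
  forall b k, row b = col b -> k \in T b -> ~~ primed k].

Definition tsize T : nat := (\sum_b #|` T b|)%N.

End Tableaux.

Notation Zbeta := {poly int}.

Definition beta {I : choiceType} : fps Zbeta I := fps_const 'X.

Definition xmon lam mu (T : filling lam mu) : fps Zbeta nat :=
  \prod_b \prod_(k <- T b) fps_var Zbeta k./2.

Definition tableau_gf (lam mu : spart) (A : set (filling lam mu)) : fps Zbeta nat :=
  if `[< psub mu lam >] then
    fps_sum A (fun T => beta ^+ (tsize T - #|` skewSD lam mu|) * xmon T)
  else 0.

Definition GPskew (lam mu : spart) := tableau_gf (@SetShYT_P lam mu).
Definition GQskew (lam mu : spart) := tableau_gf (@SetShYT_Q lam mu).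

Definition GP (lam : spart) := GPskew lam spart0.
Definition GQ (lam : spart) := GQskew lam spart0.

Definition dskew (G : spart -> spart -> fps Zbeta nat) (lam mu : spart) :
    fps Zbeta nat :=
  if `[< psub mu lam >] then
    fps_sum [set nu | psub nu mu /\ forall b, b \in skewSD mu nu -> removable mu b]
      (fun nu => beta ^+ #|` skewSD mu nu| * G lam nu)
  else 0.

Definition GPdskew := dskew GPskew.
Definition GQdskew := dskew GQskew.

(* Series in two alphabets: inl i is x_(i+1) and inr j is y_(j+1). *)
Notation fps_xy := (fps Zbeta (nat + nat)%type).

Definition in_x (f : fps Zbeta nat) : fps_xy := fps_rename inl f.
Definition in_y (f : fps Zbeta nat) : fps_xy := fps_rename inr f.

Definition xvar (i : nat) : fps_xy := fps_var Zbeta (inl i).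
Definition yvar (j : nat) : fps_xy := fps_var Zbeta (inr j).

Definition xbar (i : nat) : fps_xy := - xvar i / (1 + beta * xvar i).

Definition cauchy_factor (i j : nat) : fps_xy :=
  (1 - xbar i * yvar j) / (1 - xvar i * yvar j).

Definition cauchy_partial (n : nat) : fps_xy :=
  \prod_(i < n) \prod_(j < n) cauchy_factor i j.

Definition cauchy : fps_xy := fps_lim cauchy_partial.

Local Lemma factorE (S : comUnitRingType) (x y u : S) :
  1 - x * y \is a GRing.unit ->
  (1 - - x / u * y) / (1 - x * y) = 1 + x * y * ((1 + u^-1) / (1 - x * y)).
Proof.
move=> U; rewrite mulrA -[X in X + _ / _](divrr U) -mulrDl; congr (_ / _).
by rewrite mulrDr mulr1 addrA subrK !mulNr opprK mulrAC.
Qed.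

Local Lemma coef_var_mul (I : choiceType) (v : I) (f g : fps Zbeta I) (m : monom I) :
  v \notin m -> (f * (1 + fps_var Zbeta v * g)) m = f m.
Proof.
move=> vm; rewrite mulrDr mulr1 mulrCA coef_fpsD coef_fpsM fsbig1 ?addr0//.
move=> p pm; rewrite [fps_var]unlock; case: eqP => [pv|_]; last by rewrite mul0r.
by move: vm; rewrite -pm /= in_msetD pv in_mset1 eqxx.
Qed.

Local Lemma coef_prod_var (I : choiceType) (n : nat) (v : nat -> I)
    (f : fps Zbeta I) (F g : nat -> fps Zbeta I) (m : monom I) :
  (forall j, F j = 1 + fps_var Zbeta (v j) * g j) -> (forall j, v j \notin m) ->
  (f * \prod_(j < n) F j) m = f m.
Proof.
move=> FE vm; elim: n => [|n IH]; first by rewrite big_ord0 mulr1.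
by rewrite big_ord_recr mulrA FE coef_var_mul.
Qed.

Local Lemma cauchy_factorE i j : cauchy_factor i j = 1 + xvar i * yvar j *
  ((1 + (1 + beta * xvar i)^-1) / (1 - xvar i * yvar j)).
Proof.
have U : 1 - xvar i * yvar j \is a GRing.unit.
  apply: fps_unit_coef0; rewrite coef_fpsD coef_fpsN coef_fps1 eqxx coef_fpsM.
  rewrite fsbig1 ?subr0// => p /= pm.
  rewrite /xvar [fps_var]unlock; case: eqP => [p1|_]; last by rewrite mul0r.
  by move: (in_mset0 (inl i : (nat + nat)%type)); rewrite -pm in_msetD p1 in_mset1 eqxx.
exact: factorE U.
Qed.

Local Lemma cauchy_partialS n : cauchy_partial n.+1 =
  cauchy_partial n * (\prod_(i < n) cauchy_factor i n)
                   * \prod_(j < n.+1) cauchy_factor n j.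
Proof.
rewrite /cauchy_partial big_ord_recr/=; congr (_ * _).
rewrite -big_split/=; apply: eq_bigr => i _.
by rewrite big_ord_recr.
Qed.

Lemma cauchy_cvg m :
  exists N, forall n, (N <= n)%N -> cauchy_partial n m = cauchy m.
Proof.
pose idx (v : nat + nat) := match v with inl i => i | inr j => j end.
have [N Nm] : exists N, forall v, (N <= idx v)%N -> v \notin m.
  exists (\max_(v <- enum_mset m) idx v).+1 => v; apply: contraL => vm; rewrite -ltnNge ltnS.
  by rewrite (big_rem v vm)/= leq_maxl.
have stab n : (N <= n)%N -> cauchy_partial n m = cauchy_partial N m.
  move=> Nn; rewrite -(subnKC Nn); elim: (n - N)%N => [|k IH]; first by rewrite addn0.
  rewrite addnS -IH; move: (leq_addr k N); move: (N + k)%N => l Nl.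
  rewrite cauchy_partialS (@coef_prod_var _ _ (fun=> inl l) _ _ (fun j => yvar j *
     ((1 + (1 + beta * xvar l)^-1) / (1 - xvar l * yvar j)))).
  - apply: (@coef_prod_var _ _ (fun=> inr l) _ (cauchy_factor^~ l) (fun i => xvar i *
      ((1 + (1 + beta * xvar i)^-1) / (1 - xvar i * yvar l)))).
    + by move=> i; rewrite cauchy_factorE -mulrA mulrCA.
    + by move=> i; exact: Nm.
  - by move=> j; rewrite cauchy_factorE -mulrA.
  - by move=> j; exact: Nm.
have [M ME] : [set c | exists N, forall n, (N <= n)%N -> cauchy_partial n m = c]
    (cauchy m).
  by apply: xgetPex; exists (cauchy_partial N m), N.
by exists M.
Qed.

(* The series G lam are linearly independent, so this determines g. *)
Definition is_dual (G g : spart -> fps Zbeta nat) : Prop :=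
  fps_summable [set: spart] (fun lam => in_x (G lam) * in_y (g lam)) /\
  fps_sum [set: spart] (fun lam => in_x (G lam) * in_y (g lam)) = cauchy.

(* The product c^lam_(mu nu) beta^(|lam| - |mu| - |nu|); the subtraction is
   truncated, see the first clause of is_structure_constants. *)
Definition bcoef (c : spart -> spart -> spart -> int) (lam mu nu : spart) :
    fps Zbeta nat :=
  (c lam mu nu)%:~R * beta ^+ (psize lam - psize mu - psize nu).

(* The series G lam being linearly independent, this determines c; the first
   clause says that no negative power of beta occurs. *)
Definition is_structure_constants (G : spart -> fps Zbeta nat)
    (c : spart -> spart -> spart -> int) : Prop :=
  (forall lam mu nu, (psize lam < psize mu + psize nu)%N -> c lam mu nu = 0) /\
  forall mu nu,
    fps_summable [set: spart] (fun lam => bcoef c lam mu nu * G lam) /\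
    G mu * G nu = fps_sum [set: spart] (fun lam => bcoef c lam mu nu * G lam).

Definition dual_skew (c : spart -> spart -> spart -> int)
    (g : spart -> fps Zbeta nat) (lam mu : spart) : fps Zbeta nat :=
  fps_sum [set: spart] (fun nu => bcoef c lam mu nu * g nu).

(* Main.v *)
Require Import Defs.
From HB Require Import structures.
From mathcomp Require Import all_boot all_order all_algebra.
From mathcomp Require Import finmap multiset.
From mathcomp Require Import boolp classical_sets functions cardinality fsbigop.
From mathcomp Require Import zify ring.

Set Implicit Arguments.
Unset Strict Implicit.
Unset Printing Implicit Defensive.

Import GRing.Theory.

Local Open Scope classical_set_scope.
Local Open Scope ring_scope.

(** Write K for the Cauchy kernel and G for GP or GQ.  The definitions of the dual
    family and of the structure constants give
      sum_lam G_lam(x) g_(lam/nu)(y) = G_nu(x) K(x, y).                          (1)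
    Substitute for x a concatenated alphabet z_1, ..., z_n, x_1, x_2, ...; no
    symmetry of G is needed, since this only renumbers the variables.  Cutting a
    set-valued tableau of shape lam at the value n gives
      G_lam(z, x) = sum_mu G_mu(z) G_(lam//mu)(x):
    mu collects the boxes with a z-entry, and the boxes having both kinds of
    entries are removable boxes of mu.  As K(z, x; y) = K(z, y) K(x, y), both sides
    of (1) become combinations of the G_mu(z), the right-hand side after a second
    use of (1).  Letting n grow, linear independence of the G_mu allows one to
    compare the coefficients of G_mu(z), which are the two sides of the theorem. *)

(** * Splittings of monomials *)

Section Multisets.
Variable I : choiceType.
Implicit Types (a b m : monom I).

Lemma seq_mset_nil : seq_mset [::] = mset0 :> monom I.
Proof. by apply/msetP => x; rewrite mset_seqE mset0E. Qed.

Lemma perm_msetD a b : perm_eq (a `+` b)%mset (a ++ b).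
Proof.
apply/eq_seq_msetP; rewrite seq_mset_id.
by apply/msetP => x; rewrite mset_seqE count_cat !count_mem_mset msetE2.
Qed.

Lemma size_msetD a b : size (a `+` b)%mset = (size a + size b)%N.
Proof. by rewrite (perm_size (perm_msetD a b)) size_cat. Qed.

Lemma all_msetD (S : pred I) a b : all S (a `+` b)%mset = all S a && all S b.
Proof. by rewrite (perm_all S (perm_msetD a b)) all_cat. Qed.

Lemma msubset_addr a b : (a `<=` a `+` b)%mset.
Proof. by apply/msubsetP => x; rewrite msetE2 leq_addr. Qed.

Lemma msubset_addl a b : (b `<=` a `+` b)%mset.
Proof. by rewrite msetDC msubset_addr. Qed.

Lemma mdisjointP a b : reflect {in a, forall x, x \notin b} (mdisjoint a b).
Proof.
apply: (iffP eqP) => [/msetP ab0 x xa|ab].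
  by apply/negP => xb; move: (in_mset0 x); rewrite in_mset -ab0 -in_mset in_msetI xa xb.
apply/msetP => x; rewrite mset0E; apply/eqP; rewrite mset_eq0 in_msetI.
by apply/negP => /andP[/ab/negP].
Qed.

Lemma mdisjoint_sym a b : mdisjoint a b = mdisjoint b a.
Proof. by rewrite /mdisjoint msetIC. Qed.

Lemma mdisjoint_mult a b x : mdisjoint a b -> a x = 0%N \/ b x = 0%N.
Proof.
move=> /mdisjointP ab; have [/ab xb|xa] := boolP (x \in a); [right|left];
  exact/mset_eq0P.
Qed.

Lemma msetDI_disjoint a b (p q : monom I) :
  {subset p <= a} -> {subset q <= b} -> mdisjoint a b -> (p `+` q = a `+` b)%mset -> p = a.
Proof.
move=> pa qb ab /msetP sumE; apply/msetP => x; move: (sumE x); rewrite !msetE2.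
have [a0|b0] := mdisjoint_mult x ab.
  suff -> : p x = 0%N by rewrite a0.
  by apply/mset_eq0P; apply: contra (introT mset_eq0P a0); exact: pa.
suff -> : q x = 0%N by rewrite b0; lia.
by apply/mset_eq0P; apply: contra (introT mset_eq0P b0); exact: qb.
Qed.

Lemma msetDIK_disjoint a b (p q : monom I) :
  (p `<=` a)%mset -> (q `<=` b)%mset -> mdisjoint a b -> ((p `+` q) `&` a)%mset = p.
Proof.
move=> /msubsetP pa /msubsetP qb ab; apply/msetP => x; rewrite !msetE2.
have := pa x; have := qb x; have := mdisjoint_mult x ab; lia.
Qed.

Lemma msetDIKC_disjoint a b (p q : monom I) :
  (p `<=` a)%mset -> (q `<=` b)%mset -> mdisjoint a b -> ((p `+` q) `&` b)%mset = q.
Proof. by move=> pa qb ab; rewrite msetDC (@msetDIK_disjoint b a)// mdisjoint_sym. Qed.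

Lemma msetID_disjoint a b (p : monom I) : (p `<=` a `+` b)%mset -> mdisjoint a b ->
  ((p `&` a) `+` (p `&` b))%mset = p.
Proof.
move=> /msubsetP pab ab; apply/msetP => x; rewrite !msetE2.
have := pab x; rewrite msetE2; have := mdisjoint_mult x ab; lia.
Qed.

Lemma finite_msplit m : finite_set (msplit m).
Proof.
rewrite -(seq_mset_id m); elim: (enum_mset m) => [|x s IH].
  apply: (@sub_finite_set _ _ [set (mset0, mset0)]); last exact: finite_set1.
  move=> [a b] /= /msetP ab0; congr (_, _); apply/msetP => y; move: (ab0 y);
    by rewrite mset_seqE /= mset0E msetE2; lia.
pose to_left (p : monom I * monom I) := ((x +` p.1)%mset, p.2).
pose to_right (p : monom I * monom I) := (p.1, (x +` p.2)%mset).
apply: (@sub_finite_set _ _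
    ((to_left @` msplit (seq_mset s)) `|` (to_right @` msplit (seq_mset s)))).
  move=> [a b]; rewrite /msplit /= mset_cons => abE.
  have /orP[xa|xb] : (x \in a) || (x \in b) by rewrite -in_msetD abE mset1D1.
  - left; exists ((a `\ x)%mset, b); rewrite /to_left /= ?msetB1K//.
    by apply: (can_inj (msetDKB [mset x]%mset)); rewrite msetDA msetB1K.
  - right; exists (a, (b `\ x)%mset); rewrite /to_right /= ?msetB1K//.
    by apply: (can_inj (msetDKB [mset x]%mset)); rewrite msetDCA msetB1K.
by rewrite finite_setU; split; exact: finite_image.
Qed.

Definition splits m : seq (monom I * monom I) := fset_set (msplit m).

Lemma splits_uniq m : uniq (splits m).
Proof. exact: fset_uniq. Qed.

Lemma mem_splits m (p : monom I * monom I) :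
  (p \in splits m) = ((p.1 `+` p.2)%mset == m).
Proof.
have := in_fset_set (finite_msplit m) p; rewrite /splits => ->.
by apply/idP/eqP; rewrite inE.
Qed.

Definition add_splits (p q : monom I * monom I) := ((p.1 `+` q.1)%mset, (p.2 `+` q.2)%mset).

Lemma perm_splits_disjoint a b : mdisjoint a b ->
  perm_eq (splits (a `+` b)%mset) [seq add_splits p q | p <- splits a, q <- splits b].
Proof.
move=> ab; pose part m (r : monom I * monom I) := ((r.1 `&` m)%mset, (r.2 `&` m)%mset).
have part_splits c d (cd : mdisjoint c d) r : (r.1 `+` r.2 = c `+` d)%mset ->
    part c r \in splits c.
  case: r => u v /= /msetP uv; rewrite mem_splits; apply/eqP/msetP => x /=.
  have := uv x; rewrite !msetE2; have := mdisjoint_mult x cd; lia.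
have add_splitsK : {in [seq (p, q) | p <- splits a, q <- splits b],
    cancel (uncurry add_splits) (fun r => (part a r, part b r))}.
  move=> _ /allpairsP[[[p1 p2] [q1 q2]] [+ + ->]].
  rewrite !mem_splits /= => /eqP pa /eqP qb.
  have [p1a p2a] : (p1 `<=` a)%mset /\ (p2 `<=` a)%mset.
    by rewrite -pa msubset_addl msubset_addr.
  have [q1b q2b] : (q1 `<=` b)%mset /\ (q2 `<=` b)%mset.
    by rewrite -qb msubset_addl msubset_addr.
  by rewrite /part /= !(@msetDIK_disjoint a b)// !(@msetDIKC_disjoint a b).
apply: uniq_perm => [||r]; first exact: splits_uniq.
  by apply: allpairs_uniq; rewrite ?splits_uniq//; exact: can_in_inj add_splitsK.
rewrite mem_splits; apply/eqP/allpairsP => [r_ab|[[p q] /= []]]; last first.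
  by rewrite !mem_splits => /eqP <- /eqP <- ->; rewrite /= msetDACA.
exists (part a r, part b r); split => /=.
- exact: part_splits r_ab.
- by apply: (part_splits b a); rewrite 1?mdisjoint_sym// [RHS]msetDC.
by rewrite [LHS]surjective_pairing; congr (_, _);
  rewrite /= msetID_disjoint// -r_ab ?msubset_addl ?msubset_addr.
Qed.

Section Sums.
Variable A : nmodType.
Implicit Types F : monom I -> monom I -> A.

Lemma sum_splits_only a b F :
  (forall p q, (p `+` q = a `+` b)%mset -> p != a -> F p q = 0) ->
  \sum_(p <- splits (a `+` b)%mset) F p.1 p.2 = F a b.
Proof.
move=> F0; rewrite (bigD1_seq (a, b)) ?splits_uniq//=; last by rewrite mem_splits.
rewrite big_seq_cond big1 ?addr0// => -[p q] /=.
rewrite mem_splits xpair_eqE /= => /andP[/eqP sumE pq_ne]; apply: F0 => //.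
apply: contraNneq pq_ne => pa; move: sumE; rewrite pa eqxx.
by move=> /(can_inj (@msetDKB _ a)) -> /=.
Qed.

Lemma sum_splits_disjoint a b F : mdisjoint a b ->
  \sum_(p <- splits (a `+` b)%mset) F p.1 p.2 =
  \sum_(p <- splits a) \sum_(q <- splits b) F (p.1 `+` q.1)%mset (p.2 `+` q.2)%mset.
Proof. by move=> ab; rewrite (perm_big _ (perm_splits_disjoint ab)) big_allpairs_dep. Qed.

End Sums.

End Multisets.

Section MsetMap.
Variables (I J : choiceType) (h : I -> J).
Implicit Types m : monom I.

Definition mset_map m : monom J := seq_mset [seq h i | i <- m].

Lemma perm_mset_map m : perm_eq (mset_map m) [seq h i | i <- m].
Proof. exact: perm_eq_seq_mset. Qed.

Lemma mem_mset_map m y : (y \in mset_map m) = (y \in [seq h i | i <- m]).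
Proof. exact: perm_mem (perm_mset_map m) y. Qed.

Lemma mset_map_eq0 m y : (forall x, h x <> y) -> mset_map m y = 0%N.
Proof.
by move=> hy; apply/mset_eq0P; rewrite mem_mset_map; apply/mapP => -[x _ /esym/hy].
Qed.

Lemma mset_map_seq s : mset_map (seq_mset s) = seq_mset [seq h i | i <- s].
Proof. exact/eq_seq_msetP/perm_map/perm_eq_seq_mset. Qed.

Lemma size_mset_map m : size (mset_map m) = size m.
Proof. by rewrite (perm_size (perm_mset_map m)) size_map. Qed.

Lemma all_mset_map (S : pred J) m : all S (mset_map m) = all (S \o h) m.
Proof. by rewrite (perm_all S (perm_mset_map m)) all_map. Qed.

Lemma mset_map0 : mset_map mset0 = mset0.
Proof. by rewrite /mset_map enum_mset0 seq_mset_nil. Qed.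

Lemma mset_map1 x : mset_map [mset x]%mset = [mset h x]%mset.
Proof.
by apply/msetP => y; rewrite mset_seqE enum_msetn /= addn0 msetnE eq_sym; case: eqP.
Qed.

Lemma mset_mapD m m' : mset_map (m `+` m')%mset = (mset_map m `+` mset_map m')%mset.
Proof.
apply/msetP => y; rewrite msetE2 !mset_seqE -count_cat -map_cat.
exact/permP/perm_map/perm_msetD.
Qed.

Lemma mset_map_preimage (p : monom J) :
  {in p, forall y, exists x, y = h x} -> exists m, p = mset_map m.
Proof.
move=> ph; suff [s ps] : exists s, enum_mset p = [seq h i | i <- s].
  by exists (seq_mset s); rewrite mset_map_seq -ps seq_mset_id.
have {}ph : {in enum_mset p, forall y, exists x, y = h x} by move=> y /ph.
elim: (enum_mset p) ph => [|y s IH] ph; first by exists [::].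
have [x ->] := ph y (mem_head _ _).
have [t ->] : exists t, s = [seq h i | i <- t].
  by apply: IH => z zs; apply: ph; rewrite inE zs orbT.
by exists (x :: t).
Qed.

Hypothesis h_inj : injective h.

Lemma mset_mapE m x : mset_map m (h x) = m x.
Proof.
rewrite mset_seqE count_map -count_mem_mset; apply: eq_count => y /=.
by rewrite (inj_eq h_inj).
Qed.

Lemma mset_map_inj : injective mset_map.
Proof. by move=> m m' /msetP map_eq; apply/msetP => x; rewrite -!mset_mapE map_eq. Qed.

Lemma perm_splits_map m :
  perm_eq (splits (mset_map m)) [seq (mset_map p.1, mset_map p.2) | p <- splits m].
Proof.
apply: uniq_perm => [||[p q]]; first exact: splits_uniq.
  rewrite map_inj_uniq ?splits_uniq// => -[a b] [c d] [].
  by move/mset_map_inj -> => /mset_map_inj ->.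
rewrite mem_splits /=; apply/eqP/mapP => [pq_m|[[u v]]]; last first.
  by rewrite mem_splits => /eqP /= <- [-> ->]; rewrite mset_mapD.
have preimage r : (r `<=` mset_map m)%mset -> exists s, r = mset_map s.
  move=> /msubset_subset rm; apply: mset_map_preimage => y /rm.
  by rewrite mem_mset_map => /mapP[x _ ->]; exists x.
have /preimage[a pa] : (p `<=` mset_map m)%mset by rewrite -pq_m msubset_addr.
have /preimage[b qb] : (q `<=` mset_map m)%mset by rewrite -pq_m msubset_addl.
exists (a, b); rewrite /= ?pa ?qb// mem_splits /=.
by apply/eqP/mset_map_inj; rewrite mset_mapD -pa -qb.
Qed.

Lemma sum_splits_map (A : nmodType) m (F : monom J -> monom J -> A) :
  \sum_(p <- splits (mset_map m)) F p.1 p.2 =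
  \sum_(p <- splits m) F (mset_map p.1) (mset_map p.2).
Proof. by rewrite (perm_big _ (perm_splits_map m)) big_map. Qed.

End MsetMap.

Lemma mset_map_comp (I J K : choiceType) (g : J -> K) (h : I -> J) (m : monom I) :
  mset_map g (mset_map h m) = mset_map (g \o h) m.
Proof. by rewrite mset_map_seq -map_comp. Qed.

Definition all_lt n (s : seq nat) : bool := all (fun i => (i < n)%N) s.

Lemma exists_all_lt s : exists n, all_lt n s.
Proof.
exists (\max_(i <- s) i).+1; apply/allP => i i_s.
by rewrite ltnS leq_bigmax_seq.
Qed.

Section Concatenation.
Variable n : nat.
Implicit Types m : monom nat.

(* The monomial m1(z) m2(x) in the variables z_1, ..., z_n, x_1, x_2, ..., provided that
   m1 involves only the first n variables. *)
Definition concat_monom m1 m2 : monom nat := (m1 `+` mset_map (addn n) m2)%mset.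

Lemma size_concat_monom m1 m2 : size (concat_monom m1 m2) = (size m1 + size m2)%N.
Proof. by rewrite size_msetD size_mset_map. Qed.

Lemma all_lt_splits m (p : monom nat * monom nat) :
  all_lt n m -> p \in splits m -> all_lt n p.1 /\ all_lt n p.2.
Proof. by rewrite mem_splits => m_lt /eqP pm; apply/andP; rewrite -all_msetD pm. Qed.

Lemma concat_monom_disjoint m1 m2 : all_lt n m1 -> mdisjoint m1 (mset_map (addn n) m2).
Proof.
move=> /allP m1_lt; apply/mdisjointP => i /m1_lt i_lt.
by rewrite mem_mset_map; apply/mapP => -[j _]; lia.
Qed.

Lemma concat_monom_inj m1 m2 m1' m2' : all_lt n m1 -> all_lt n m1' ->
  concat_monom m1 m2 = concat_monom m1' m2' -> m1 = m1' /\ m2 = m2'.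
Proof.
move=> m1_lt m1'_lt concatE; have m1_eq : m1 = m1'.
  apply/msetP => i; have [ni|ni] := ltnP i n.
    by move/msetP/(_ i): concatE; rewrite !msetE2 !mset_map_eq0 ?addn0// => j; lia.
  have mult0 m : all_lt n m -> m i = 0%N.
    by move=> /allP m_lt; apply/mset_eq0P/negP => /m_lt; rewrite ltnNge ni.
  by rewrite !mult0.
split=> //; move: concatE; rewrite /concat_monom m1_eq => /(can_inj (@msetDKB _ m1')).
exact/mset_map_inj/addnI.
Qed.

Lemma sum_splits_concat (A : nmodType) m1 m2 (F : monom nat -> monom nat -> A) :
  all_lt n m1 ->
  \sum_(p <- splits (concat_monom m1 m2)) F p.1 p.2 =
  \sum_(p <- splits m1) \sum_(r <- splits m2)
    F (concat_monom p.1 r.1) (concat_monom p.2 r.2).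
Proof.
move=> m1_lt; rewrite sum_splits_disjoint; last exact: concat_monom_disjoint.
apply: eq_bigr => p _.
exact: (sum_splits_map (@addnI n) _ (fun a b => F (p.1 `+` a)%mset (p.2 `+` b)%mset)).
Qed.

End Concatenation.

(** * Coefficients of power series *)

Section Coefficients.
Variables (R : comNzRingType) (I : choiceType).
Implicit Types (f g : fps R I) (m : monom I).

Lemma coef_fps0 m : (0 : fps R I) m = 0.
Proof. by []. Qed.

Lemma coef_fpsM_splits f g m : (f * g) m = \sum_(p <- splits m) f p.1 * g p.2.
Proof. by rewrite coef_fpsM fsbig_finite //; exact: finite_msplit. Qed.

Lemma coef_fps_constM (c : R) f m : (fps_const c * f) m = c * f m.
Proof.
rewrite coef_fpsM_splits -{1}(mset0D m).
rewrite (sum_splits_only (a := mset0) (F := fun p q => _ p * f q)).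
  by rewrite [fps_const]unlock eqxx.
by move=> p q _ p0; rewrite [fps_const]unlock (negbTE p0) mul0r.
Qed.

Lemma fps_const_is_zmod_morphism : zmod_morphism (@fps_const R I).
Proof.
move=> c d; apply/funext => m; rewrite coef_fpsD coef_fpsN [fps_const]unlock.
by case: ifP; rewrite ?subr0.
Qed.

Lemma fps_const_is_monoid_morphism : monoid_morphism (@fps_const R I).
Proof.
split=> [//|c d]; apply/funext => m; rewrite coef_fps_constM [fps_const]unlock.
by case: ifP; rewrite ?mulr0.
Qed.

HB.instance Definition _ := GRing.isZmodMorphism.Build _ _ (@fps_const R I)
  fps_const_is_zmod_morphism.
HB.instance Definition _ := GRing.isMonoidMorphism.Build _ _ (@fps_const R I)
  fps_const_is_monoid_morphism.

Lemma coef_fps_varM0 (i : I) f : (fps_var R i * f) mset0 = 0.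
Proof.
rewrite coef_fpsM_splits big_seq big1// => -[p q]; rewrite mem_splits /= => /eqP pq0.
rewrite [fps_var]unlock; case: eqP => [pi|]; last by rewrite mul0r.
by move: (in_mset0 i); rewrite -pq0 pi mset1D1.
Qed.

Lemma coef_prod_fps_var (s : seq I) m :
  (\prod_(i <- s) fps_var R i) m = (m == seq_mset s)%:R.
Proof.
elim: s m => [|x s IH] m.
  by rewrite big_nil coef_fps1 seq_mset_nil.
rewrite big_cons coef_fpsM_splits mset_cons.
pose F (p q : monom I) : R := (p == [mset x]%mset)%:R * (q == seq_mset s)%:R.
transitivity (\sum_(p <- splits m) F p.1 p.2).
  by apply: eq_bigr => p _; rewrite IH [fps_var]unlock.
have [->|m_ne] := eqVneq m (x +` seq_mset s)%mset.
  rewrite sum_splits_only /F.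
    by rewrite !eqxx mulr1.
  by move=> p q _ /negbTE ->; rewrite mul0r.
rewrite big_seq big1// => -[p q]; rewrite mem_splits /F /= => /eqP pq_m.
case: eqP => [px|]; last by rewrite mul0r.
by case: eqP => [qs|]; [rewrite -pq_m px qs eqxx in m_ne | rewrite mulr0].
Qed.

End Coefficients.

Section Pull.
Variables (R : comNzRingType) (I J : choiceType) (h : I -> J).

(* Sends the variable h i to i and kills the variables outside the image of h. *)
Definition fps_pull (_ : injective h) (f : fps R J) : fps R I := fun m => f (mset_map h m).

Variable h_inj : injective h.

Lemma fps_pull_is_zmod_morphism : zmod_morphism (fps_pull h_inj).
Proof. by []. Qed.

Lemma fps_pull_is_monoid_morphism : monoid_morphism (fps_pull h_inj).
Proof.
split=> [|f g]; apply/funext => m; rewrite /fps_pull.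
  by rewrite !coef_fps1 -(mset_map0 h) (inj_eq (mset_map_inj h_inj)).
by rewrite !coef_fpsM_splits (sum_splits_map h_inj _ (fun p q => f p * g q)).
Qed.

HB.instance Definition _ := GRing.isZmodMorphism.Build _ _ (fps_pull h_inj)
  fps_pull_is_zmod_morphism.
HB.instance Definition _ := GRing.isMonoidMorphism.Build _ _ (fps_pull h_inj)
  fps_pull_is_monoid_morphism.

Lemma fps_pull_const c : fps_pull h_inj (fps_const c) = fps_const c.
Proof.
apply/funext => m; rewrite /fps_pull [fps_const]unlock.
by rewrite -{1}(mset_map0 h) (inj_eq (mset_map_inj h_inj)).
Qed.

Lemma fps_pull_var i : fps_pull h_inj (fps_var R (h i)) = fps_var R i.
Proof.
apply/funext => m; rewrite /fps_pull [fps_var]unlock.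
by rewrite -(mset_map1 h) (inj_eq (mset_map_inj h_inj)).
Qed.

End Pull.

Section Restriction.
Variables (R : comNzRingType) (I : choiceType) (S : pred I).
Implicit Types f g : fps R I.

Definition fps_restrict f : fps R I := fun m => if all S m then f m else 0.

Lemma fps_restrict_is_zmod_morphism : zmod_morphism fps_restrict.
Proof.
move=> f g; apply/funext => m; rewrite coef_fpsD coef_fpsN /fps_restrict.
by case: ifP; rewrite ?subr0.
Qed.

Lemma fps_restrict_is_monoid_morphism : monoid_morphism fps_restrict.
Proof.
split=> [|f g]; apply/funext => m; rewrite /fps_restrict.
  by rewrite coef_fps1; case: eqP => [->|]; rewrite ?enum_mset0 //=; case: ifP.
rewrite !coef_fpsM_splits; case: ifPn => Sm.
  rewrite big_seq [RHS]big_seq; apply: eq_bigr => p; rewrite mem_splits => /eqP pq_m.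
  by move: Sm; rewrite -pq_m all_msetD => /andP[-> ->].
rewrite big_seq big1// => -[p q]; rewrite mem_splits /= => /eqP pq_m.
move: Sm; rewrite -pq_m all_msetD negb_and => /orP[/negbTE ->|/negbTE ->];
  by rewrite ?mulr0 ?mul0r.
Qed.

HB.instance Definition _ := GRing.isZmodMorphism.Build _ _ fps_restrict
  fps_restrict_is_zmod_morphism.
HB.instance Definition _ := GRing.isMonoidMorphism.Build _ _ fps_restrict
  fps_restrict_is_monoid_morphism.

Lemma fps_restrict_const c : fps_restrict (fps_const c) = fps_const c.
Proof.
apply/funext => m; rewrite /fps_restrict [fps_const]unlock.
by case: eqP => [->|]; rewrite ?enum_mset0//; case: ifP.
Qed.

Lemma fps_restrict_var i :
  fps_restrict (fps_var R i) = if S i then fps_var R i else 0.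
Proof.
apply/funext => m; rewrite /fps_restrict [fps_var]unlock.
case: eqP => [->|]; first by rewrite enum_msetn /= andbT; case: ifP => //; rewrite eqxx.
by move/eqP/negbTE => m_ne; rewrite if_same; case: ifP; rewrite ?m_ne.
Qed.

Lemma fps_restrict_supp f m : fps_restrict f = f -> f m != 0 -> all S m.
Proof. by move=> fS; apply: contraNT => Sm; rewrite -fS /fps_restrict (negbTE Sm). Qed.

End Restriction.

Section Rename.
Variables (R : comNzRingType) (I J : choiceType) (h : I -> J).
Implicit Type f : fps R I.

Lemma fps_rename_supp f p : fps_rename h f p != 0 -> exists m, p = mset_map h m.
Proof.
move=> /eqP fp; apply: contrapT => not_map; apply: fp.
by rewrite /fps_rename fsbig1// => m /= mp; case: not_map; exists m.
Qed.

Lemma fps_rename_map f m : injective h -> fps_rename h f (mset_map h m) = f m.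
Proof.
move=> h_inj; rewrite /fps_rename.
transitivity (\sum_(n \in [set m]) f n); last by rewrite fsbig_set1.
by apply: eq_fsbigl; apply/seteqP; split=> n /= => [/(mset_map_inj h_inj)|->].
Qed.

End Rename.

(** * The Cauchy kernel *)

Section TwoAlphabets.
Implicit Types (m k : monom nat) (f g : fps Zbeta nat).

Definition xy_monom m k : monom (nat + nat)%type := (mset_map inl m `+` mset_map inr k)%mset.

Lemma mset_map_inl_inr_disjoint m k :
  @mdisjoint (nat + nat)%type (mset_map inl m) (mset_map inr k).
Proof.
apply/mdisjointP => v; rewrite !mem_mset_map => /mapP[i _ ->].
by apply/negP => /mapP[].
Qed.

Lemma xy_monom_inj m k m' k' : xy_monom m k = xy_monom m' k' -> m = m' /\ k = k'.
Proof.
move=> /msetP xyE; split; apply/msetP => i.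
  have := xyE (inl i).
  by rewrite !msetE2 !(mset_mapE inl_inj) !(@mset_map_eq0 _ _ inr) ?addn0.
have := xyE (inr i).
by rewrite !msetE2 !(mset_mapE inr_inj) !(@mset_map_eq0 _ _ inl).
Qed.

Lemma xy_monom_surj p : exists m k, p = xy_monom m k.
Proof.
rewrite -(seq_mset_id p); elim: (enum_mset p) => [|v s [m [k IH]]].
  by exists mset0, mset0; rewrite seq_mset_nil /xy_monom !mset_map0 msetD0.
rewrite mset_cons IH; case: v => i.
  by exists (i +` m)%mset, k; rewrite /xy_monom mset_mapD mset_map1 msetDA.
by exists m, (i +` k)%mset; rewrite /xy_monom mset_mapD mset_map1 msetDCA.
Qed.

Lemma sum_splits_xy (A : nmodType) m k (F : _ -> _ -> A) :
  \sum_(p <- splits (xy_monom m k)) F p.1 p.2 =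
  \sum_(p <- splits m) \sum_(q <- splits k) F (xy_monom p.1 q.1) (xy_monom p.2 q.2).
Proof.
rewrite sum_splits_disjoint; last exact: mset_map_inl_inr_disjoint.
rewrite (sum_splits_map inl_inj _ (fun a b => \sum_(q <- splits (mset_map inr k))
    F (a `+` q.1)%mset (b `+` q.2)%mset)).
apply: eq_bigr => p _.
exact: (sum_splits_map inr_inj _ (fun a b => F (_ `+` a)%mset (_ `+` b)%mset)).
Qed.

Lemma coef_in_x_in_y f g m k : (in_x f * in_y g) (xy_monom m k) = f m * g k.
Proof.
rewrite coef_fpsM_splits (sum_splits_only (F := fun p q => in_x f p * in_y g q)).
  by rewrite /in_x /in_y !fps_rename_map//; [exact: inr_inj | exact: inl_inj].
move=> p q pq_xy; apply: contraNeq; rewrite mulf_eq0 negb_or.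
move=> /andP[/fps_rename_supp[m' pm] /fps_rename_supp[k' qk]].
by move: pq_xy; rewrite pm qk => /xy_monom_inj[-> _].
Qed.

Definition xy_pred (P Q : pred nat) (v : nat + nat) : bool :=
  match v with inl i => P i | inr j => Q j end.

Lemma all_xy_monom (P Q : pred nat) m k :
  all (xy_pred P Q) (xy_monom m k) = all P m && all Q k.
Proof. by rewrite all_msetD !all_mset_map. Qed.

End TwoAlphabets.

Lemma unit_1BxMy i j : 1 - xvar i * yvar j \is a GRing.unit.
Proof.
by apply: fps_unit_coef0; rewrite coef_fpsD coef_fpsN coef_fps_varM0 coef_fps1 eqxx subr0.
Qed.

Lemma unit_1DbetaMx i : 1 + beta * xvar i \is a GRing.unit.
Proof.
by apply: fps_unit_coef0; rewrite coef_fpsD mulrC coef_fps_varM0 coef_fps1 eqxx addr0.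
Qed.

Section CauchyFactorMorphism.
Variable phi : {rmorphism fps_xy -> fps_xy}.
Hypothesis phi_beta : phi beta = beta.

Let phi_cauchy_factor i j : phi (cauchy_factor i j) =
  (1 - - phi (xvar i) / (1 + beta * phi (xvar i)) * phi (yvar j)) /
  (1 - phi (xvar i) * phi (yvar j)).
Proof.
have phi_xbar : phi (xbar i) = - phi (xvar i) / (1 + beta * phi (xvar i)).
  by rewrite /xbar rmorph_div ?unit_1DbetaMx// rmorphN rmorphD rmorphM rmorph1 phi_beta.
rewrite /cauchy_factor rmorph_div ?unit_1BxMy// !rmorphB rmorph1.
by rewrite [phi (xbar i * _)]rmorphM phi_xbar rmorphM.
Qed.

Lemma cauchy_factor_map i j i' j' : phi (xvar i) = xvar i' -> phi (yvar j) = yvar j' ->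
  phi (cauchy_factor i j) = cauchy_factor i' j'.
Proof. by rewrite phi_cauchy_factor => -> ->. Qed.

Lemma cauchy_factor_map1 i j : phi (xvar i) = 0 \/ phi (yvar j) = 0 ->
  phi (cauchy_factor i j) = 1.
Proof.
by rewrite phi_cauchy_factor => -[] ->; rewrite ?oppr0 ?mul0r ?mulr0 subr0 divr1.
Qed.

End CauchyFactorMorphism.

Section CauchyProduct.
Implicit Types (r s : seq nat) (a b m k : monom nat).

Definition cauchy_prod r s : fps_xy := \prod_(i <- r) \prod_(j <- s) cauchy_factor i j.

Lemma cauchy_partial_iota n : cauchy_partial n = cauchy_prod (iota 0 n) (iota 0 n).
Proof.
have -> : iota 0 n = index_iota 0 n by rewrite /index_iota subn0.
by rewrite /cauchy_prod big_mkord; apply: eq_bigr => i _; rewrite big_mkord.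
Qed.

Lemma cauchy_prod_cat r1 r2 s :
  cauchy_prod (r1 ++ r2) s = cauchy_prod r1 s * cauchy_prod r2 s.
Proof. exact: big_cat. Qed.

Lemma perm_cauchy_prod r r' s s' :
  perm_eq r r' -> perm_eq s s' -> cauchy_prod r s = cauchy_prod r' s'.
Proof.
move=> rr' ss'; rewrite /cauchy_prod (perm_big _ rr').
by apply: eq_bigr => i _; exact: perm_big.
Qed.

Lemma restrict_cauchy_prod (P Q : pred nat) r s :
  fps_restrict (xy_pred P Q) (cauchy_prod r s) =
  cauchy_prod [seq i <- r | P i] [seq j <- s | Q j].
Proof.
have restrict_beta : fps_restrict (xy_pred P Q) beta = beta by exact: fps_restrict_const.
rewrite rmorph_prod [RHS]big_filter [RHS]big_mkcond; apply: eq_bigr => i _ /=.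
rewrite rmorph_prod; case: ifPn => Pi; last first.
  by rewrite big1// => j _; apply: cauchy_factor_map1 => //; left;
     rewrite /= fps_restrict_var /= (negbTE Pi).
rewrite big_filter [RHS]big_mkcond; apply: eq_bigr => j _ /=; case: ifPn => Qj.
  by apply: cauchy_factor_map => //; rewrite /= /xvar /yvar fps_restrict_var /= ?Pi ?Qj.
by apply: cauchy_factor_map1 => //; right; rewrite /= /yvar fps_restrict_var /= (negbTE Qj).
Qed.

Lemma coef_cauchy_prod_supp r s m k :
  cauchy_prod r s (xy_monom m k) != 0 -> {subset m <= r} /\ {subset k <= s}.
Proof.
have restrictK : fps_restrict (xy_pred (mem r) (mem s)) (cauchy_prod r s) = cauchy_prod r s.
  by rewrite restrict_cauchy_prod; congr cauchy_prod; apply/all_filterP/allP.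
by move=> /(fps_restrict_supp restrictK); rewrite all_xy_monom => /andP[/allP ? /allP].
Qed.

Lemma coef_cauchy r s m k : uniq r -> uniq s -> {subset m <= r} -> {subset k <= s} ->
  cauchy (xy_monom m k) = cauchy_prod r s (xy_monom m k).
Proof.
move=> r_uniq s_uniq mr ks.
have [N cauchyN] := cauchy_cvg (xy_monom m k).
have [B /allP rsB] := exists_all_lt (r ++ s); pose n := maxn N B.
have restrict_iota t : uniq t -> {subset t <= r ++ s} ->
    perm_eq [seq i <- iota 0 n | i \in t] t.
  move=> t_uniq t_rs; apply: uniq_perm => // [|i]; first by rewrite filter_uniq ?iota_uniq.
  rewrite mem_filter mem_iota; case: (boolP (i \in t)) => //= /t_rs/rsB iB.
  by rewrite add0n leq_max iB orbT.
rewrite -(cauchyN n) ?leq_maxl// cauchy_partial_iota.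
rewrite -(perm_cauchy_prod (restrict_iota r _ _) (restrict_iota s _ _))//; last 2 first.
- by move=> i ir; rewrite mem_cat ir.
- by move=> i i_s; rewrite mem_cat i_s orbT.
rewrite -restrict_cauchy_prod /fps_restrict all_xy_monom.
have -> : all (fun i => i \in r) m by apply/allP.
by have -> : all (fun j => j \in s) k by apply/allP.
Qed.

Lemma coef_cauchy_disjoint a b k : mdisjoint a b ->
  cauchy (xy_monom (a `+` b)%mset k) =
  \sum_(q <- splits k) cauchy (xy_monom a q.1) * cauchy (xy_monom b q.2).
Proof.
move=> ab; pose Ka := cauchy_prod (undup a) (undup k).
pose Kb := cauchy_prod (undup b) (undup k).
rewrite (@coef_cauchy (undup a ++ undup b) (undup k)) ?undup_uniq//; last 3 first.
- rewrite cat_uniq !undup_uniq andbT; apply/hasPn => i; rewrite !mem_undup.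
  by apply: contraL; exact: (mdisjointP _ _ ab).
- by move=> i; rewrite mem_cat !mem_undup in_msetD.
- by move=> i; rewrite mem_undup.
rewrite cauchy_prod_cat coef_fpsM_splits (sum_splits_xy _ _ (fun p q => Ka p * Kb q)).
rewrite (sum_splits_only (F := fun p q => \sum_(t <- splits k)
    Ka (xy_monom p t.1) * Kb (xy_monom q t.2))).
  rewrite big_seq [RHS]big_seq; apply: eq_bigr => -[k1 k2].
  rewrite mem_splits /Ka /Kb /= => /eqP k12.
  by rewrite -!coef_cauchy ?undup_uniq// => i; rewrite mem_undup// -k12 in_msetD => ->;
     rewrite ?orbT.
move=> p q pqE pa; apply: big1 => t _; apply: contraNeq pa; rewrite mulf_eq0 negb_or.
move=> /andP[/coef_cauchy_prod_supp[pa _] /coef_cauchy_prod_supp[qb _]]; apply/eqP.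
by apply: (@msetDI_disjoint _ a b p q) => // i; [move/pa | move/qb]; rewrite mem_undup.
Qed.

Lemma coef_cauchy_map (h : nat -> nat) m k : injective h ->
  cauchy (xy_monom (mset_map h m) k) = cauchy (xy_monom m k).
Proof.
move=> h_inj; pose hx (v : nat + nat) := if v is inl i then inl (h i) else v.
have hx_inj : injective hx by move=> [i|i] [j|j] // [ij]; rewrite ?ij // (h_inj _ _ ij).
have pull_prod r s : fps_pull hx_inj (cauchy_prod (map h r) s) = cauchy_prod r s.
  rewrite rmorph_prod big_map; apply: eq_bigr => i _.
  rewrite rmorph_prod; apply: eq_bigr => j _; apply: cauchy_factor_map.
  - exact: fps_pull_const.
  - exact: (fps_pull_var _ hx_inj (inl i)).
  - exact: (fps_pull_var _ hx_inj (inr j)).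
have subset_undup (t : monom nat) : {subset t <= undup t} by move=> i; rewrite mem_undup.
rewrite [RHS](coef_cauchy (undup_uniq m) (undup_uniq k))// -pull_prod.
rewrite (@coef_cauchy (map h (undup m)) (undup k)) ?map_inj_uniq ?undup_uniq//; last first.
  by move=> i; rewrite mem_mset_map => /mapP[j jm ->]; rewrite map_f ?mem_undup.
by rewrite /fps_pull /xy_monom mset_mapD !mset_map_comp.
Qed.

Lemma coef_cauchy_concat n a b k : all_lt n a ->
  cauchy (xy_monom (concat_monom n a b) k) =
  \sum_(q <- splits k) cauchy (xy_monom a q.1) * cauchy (xy_monom b q.2).
Proof.
move=> a_lt; rewrite coef_cauchy_disjoint; last exact: concat_monom_disjoint.
by apply: eq_bigr => q _; rewrite coef_cauchy_map//; exact: addnI.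
Qed.

End CauchyProduct.

(** * Strict partitions and their shifted diagrams *)

Notation box := (nat * nat)%type.

Definition shifted (b : box) : bool := (0 < b.1 <= b.2)%N.

Definition box_le (b c : box) : bool := (b.1 <= c.1)%N && (b.2 <= c.2)%N.

Definition shifted_ideal (D : {fset box}) : Prop :=
  {in D, forall b, shifted b} /\
  forall b c, shifted b -> box_le b c -> c \in D -> b \in D.

Section StrictPartitions.
Implicit Types (lam mu nu : spart) (b c : box) (D : {fset box}).

Lemma parts_sorted lam : sorted gtn (parts lam).
Proof. by have /andP[] := valP lam. Qed.

Lemma parts_neq0 lam : (0 \notin parts lam)%N.
Proof. by have /andP[] := valP lam. Qed.

Lemma part_eq0 lam i : (size (parts lam) <= i.-1)%N -> part lam i = 0%N.
Proof. exact: nth_default. Qed.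

Lemma part_gt0 lam i : (i.-1 < size (parts lam))%N -> (0 < part lam i)%N.
Proof.
move=> il; rewrite lt0n; apply: contraNneq (parts_neq0 lam) => <-.
exact: mem_nth.
Qed.

Lemma part_ltS lam i : (0 < i)%N -> (0 < part lam i.+1)%N -> (part lam i.+1 < part lam i)%N.
Proof.
move=> i0 pos.
have il : (i < size (parts lam))%N by case: ltnP => // il; rewrite part_eq0 in pos.
have /(_ i.-1) /= := sortedP 0%N (parts_sorted lam); rewrite prednK//; exact.
Qed.

Lemma spart_ext lam mu : (forall i, (0 < i)%N -> part lam i = part mu i) -> lam = mu.
Proof.
move=> eq_part; apply: val_inj => /=.
have size_parts : size (parts lam) = size (parts mu).
  wlog lt : lam mu eq_part / (size (parts lam) < size (parts mu))%N => [wlog_lt|].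
    case: (ltngtP (size (parts lam)) (size (parts mu))) => // lt; first exact: wlog_lt.
    by apply/esym/wlog_lt => // i /eq_part.
  have := part_gt0 (lam := mu) (i := (size (parts lam)).+1) lt.
  by rewrite -eq_part// part_eq0.
by apply: (eq_from_nth (x0 := 0%N) size_parts) => i _; exact: (eq_part i.+1).
Qed.

Lemma exists_spart (r : nat -> nat) :
  (forall i, (0 < r i.+1 -> r i.+1 < r i)%N) -> (exists i, r i = 0%N) ->
  exists lam, forall i, part lam i.+1 = r i.
Proof.
move=> r_decr r_zero; have [] := ex_minnP (P := fun i => r i == 0%N).
  by have [i ri] := r_zero; exists i; rewrite ri.
move=> L /eqP rL L_min.
have r_pos i : (i < L)%N -> (0 < r i)%N.
  by rewrite lt0n ltnNge; apply: contra => /L_min.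
have r_0 i : (L <= i)%N -> r i = 0%N.
  move/subnK <-; elim: (i - L)%N => // {}i ri; rewrite addSn.
  by apply/eqP; rewrite -leqn0 leqNgt; apply/negP => /r_decr; rewrite ri.
have parts_r : sorted gtn (mkseq r L) && (0 \notin mkseq r L)%N.
  apply/andP; split.
    apply/(sortedP 0%N) => i; rewrite size_mkseq => iL; rewrite !nth_mkseq ?(ltnW iL)//=.
    exact/r_decr/r_pos.
  by apply/mapP => -[i]; rewrite mem_iota => /r_pos + ri; rewrite -ri.
exists (Spart parts_r) => i; rewrite /part /=.
have [iL|Li] := ltnP i L; first by rewrite nth_mkseq.
by rewrite r_0// nth_default// size_mkseq.
Qed.

Lemma mem_SD lam b : (b \in SD lam) = shifted b && (b.2 < b.1 + part lam b.1)%N.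
Proof. by case: b => i j; rewrite in_SD. Qed.

Lemma SD_shifted lam b : b \in SD lam -> shifted b.
Proof. by rewrite mem_SD => /andP[]. Qed.

Lemma SD_down lam b c : shifted b -> box_le b c -> c \in SD lam -> b \in SD lam.
Proof.
case: b c => i' j' [i j]; rewrite /shifted /box_le !in_SD /=.
move=> i'j' /andP[le_i le_j] /andP[/andP[i0 ij] ji].
rewrite i'j' /=; suff : (i + part lam i <= i' + part lam i')%N by lia.
have pos : (0 < part lam i)%N by lia.
case/andP: i'j' => i'0 _ {ij ji le_j}.
elim: i le_i i0 pos => [|i IH]; first lia.
rewrite leq_eqVlt => /predU1P[<-//|le_i] _ pos.
have i0 : (0 < i)%N by lia.
have := part_ltS i0 pos; have := IH le_i i0; lia.
Qed.

Lemma initial_segment (P : pred nat) :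
  (forall j k, (j <= k)%N -> P k -> P j) -> (exists n, ~~ P n) ->
  exists n, forall j, P j = (j < n)%N.
Proof.
move=> P_down P_bounded; have [n nPn n_min] := ex_minnP P_bounded.
exists n => j; apply/idP/idP => [Pj|]; last by apply: contraLR => /n_min; rewrite -leqNgt.
by rewrite ltnNge; apply: contra nPn => /P_down; apply.
Qed.

Lemma exists_SD D : shifted_ideal D -> exists lam, SD lam = D.
Proof.
move=> [D_shifted D_down].
have [N /allP/= D_lt] := exists_all_lt [seq b.2 | b <- D].
have row_len i : exists r, forall j, ((i.+1, i.+1 + j)%N \in D) = (j < r)%N.
  apply: (initial_segment (P := fun j => (i.+1, i.+1 + j)%N \in D)) => [j k jk|].
    by apply: D_down; rewrite /shifted /box_le /=; lia.
  exists N; apply/negP => /(map_f (snd : box -> nat))/D_lt /=; lia.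
have [r rP] := choice row_len.
have [lam lam_r] : exists lam, forall i, part lam i.+1 = r i.
  apply: exists_spart => [i ri|].
    rewrite -rP; have : (i.+2, i.+2 + (r i.+1).-1)%N \in D by rewrite rP; lia.
    by apply: D_down; rewrite /shifted /box_le /=; lia.
  exists N; apply/eqP; rewrite -leqn0 leqNgt -rP.
  apply/negP => /(map_f (snd : box -> nat))/D_lt /=; lia.
exists lam; apply/fsetP => b; rewrite mem_SD.
have [bS|bS] /= := boolP (shifted b); last first.
  by apply/esym/negbTE; apply: contra bS => /D_shifted.
case: b bS => -[|i] j //= /andP[_ /= ij].
by rewrite lam_r -{2}(subnKC ij) rP; lia.
Qed.

Lemma psubP mu lam : psub mu lam <-> {subset SD mu <= SD lam}.
Proof.
split=> [le_part [i j]|SD_sub i]; first by rewrite !in_SD; have := le_part i; lia.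
wlog i0 : i / (0 < i)%N => [le_part|].
  by case: i => [|i]; [exact: (le_part 1%N)|exact: le_part].
case: (posnP (part mu i)) => [->//|pos].
have /SD_sub : (i, (i + part mu i).-1) \in SD mu by rewrite in_SD; lia.
rewrite in_SD; lia.
Qed.

Lemma SD_inj : injective SD.
Proof.
move=> lam mu SD_eq; apply: spart_ext => i _; apply/eqP.
by rewrite eqn_leq; apply/andP; split; move: i; apply/psubP => b; rewrite SD_eq.
Qed.

Lemma psub_trans nu mu lam : psub nu mu -> psub mu lam -> psub nu lam.
Proof. by move=> nm ml i; exact: leq_trans (nm i) (ml i). Qed.

Lemma psub0 lam : psub spart0 lam.
Proof. by move=> i; rewrite /part nth_nil. Qed.

Lemma skewSD0 lam : skewSD lam spart0 = SD lam.
Proof.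
apply/fsetP => b; rewrite in_fsetD [b \in SD spart0]mem_SD /part nth_nil addn0.
by rewrite mem_SD /shifted; lia.
Qed.

Lemma skewSD_inj lam mu nu : psub mu lam -> psub nu lam ->
  skewSD lam mu = skewSD lam nu -> mu = nu.
Proof.
move=> /psubP/fsubsetP ml /psubP/fsubsetP nl skew_eq.
by apply: SD_inj; rewrite -(fsetDK ml) -(fsetDK nl); congr (_ `\` _)%fset.
Qed.

Lemma sum_SD_rows lam (f : nat -> nat) :
  (\sum_(b <- SD lam) f b.1 = \sum_(i < size (parts lam)) part lam i.+1 * f i.+1)%N.
Proof.
have SD_perm : perm_eq (SD lam)
    [seq (i, j) | i <- iota 1 (size (parts lam)), j <- iota i (part lam i)].
  apply: uniq_perm => [||b]; rewrite ?fset_uniq ?inE//.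
  apply: allpairs_uniq_dep => [|i _|]; rewrite ?iota_uniq//.
  by move=> [i j] [i' j'] /= ? ? [-> ->].
rewrite (perm_big _ SD_perm) /=.
rewrite big_allpairs_dep -[1%N]addn0 iotaDl big_map.
rewrite -{1}[size _]subn0 -/(index_iota 0 _) big_mkord; apply: eq_bigr => i _.
by rewrite /= big_const_seq count_predT size_iota iter_addn_0 mulnC.
Qed.

Lemma card_SD lam : #|` SD lam| = psize lam.
Proof.
rewrite card_fset_sum1 (sum_SD_rows lam (fun=> 1%N)) /psize sumnE (big_nth 0%N) big_mkord.
by apply: eq_bigr => i _; rewrite muln1.
Qed.

Lemma SD_le_psize lam b : b \in SD lam -> (b.1 <= b.2 <= psize lam)%N.
Proof.
case: b => i j bS; have := SD_shifted bS; rewrite /shifted /= => /andP[i0 ij]; rewrite ij /=.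
have : (1%N, j) \in SD lam by apply: SD_down bS; rewrite /shifted /box_le /=; lia.
have part1 : (part lam 1 <= psize lam)%N.
  by rewrite /psize /part; case: (parts lam) => // x s; exact: leq_addr.
rewrite in_SD; lia.
Qed.

Lemma leq_psize mu lam : psub mu lam -> (psize mu <= psize lam)%N.
Proof.
by move/psubP => SD_sub; rewrite -!card_SD; apply: fsubset_leq_card; apply/fsubsetP.
Qed.

Lemma card_skewSD lam mu : psub mu lam -> (#|` skewSD lam mu| + psize mu)%N = psize lam.
Proof.
move=> /psubP ml; rewrite -!card_SD -(cardfsID (SD mu) (SD lam)) addnC; congr addn.
by congr #|` _|; apply/esym/fsetIidPr/fsubsetP.
Qed.

Lemma finite_psize N : finite_set [set lam | (psize lam <= N)%N].
Proof.
pose side := [fset i in iota 0 N.+1]%fset.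
have sideP i : (i <= N)%N -> i \in side by rewrite !inE /= mem_iota; lia.
apply: (@sub_finite_set _ _ (SD @^-1` [set` fpowerset (side `*` side)%fset])).
  move=> lam lamN; rewrite /= fpowersetE; apply/fsubsetP => b /SD_le_psize blam.
  by rewrite in_fsetM !sideP//; move: blam lamN => /=; lia.
apply: finite_preimage; last exact: finite_fset.
by move=> lam mu _ _; exact: SD_inj.
Qed.

Definition sparts_upto N : {fset spart} := fset_set [set lam | (psize lam <= N)%N].

Lemma mem_sparts_upto N lam : (lam \in sparts_upto N) = (psize lam <= N)%N.
Proof.
rewrite in_fset_set; last exact: finite_psize.
by apply/idP/idP => [/set_mem|?]; rewrite ?inE.
Qed.

Lemma fsbig_sparts_upto (A : nmodType) N (F : spart -> A) :
  (forall lam, F lam != 0 -> (psize lam <= N)%N) ->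
  \sum_(lam \in [set: spart]) F lam = \sum_(lam <- sparts_upto N) F lam.
Proof.
move=> F_supp; apply: fsbigTE => lam; rewrite mem_sparts_upto => /negP n.
by apply/eqP/negPn/negP => /F_supp.
Qed.

Lemma sum_sparts_upto_widen (A : nmodType) N N' (F : spart -> A) :
  (forall lam, F lam != 0 -> (psize lam <= N)%N /\ (psize lam <= N')%N) ->
  \sum_(lam <- sparts_upto N) F lam = \sum_(lam <- sparts_upto N') F lam.
Proof. by move=> F_supp; rewrite -!fsbig_sparts_upto// => lam /F_supp[]. Qed.

Definition removable_strip mu nu : Prop :=
  psub nu mu /\ forall b, b \in skewSD mu nu -> removable mu b.

Lemma removable_max mu b c : removable mu b -> c \in SD mu -> box_le b c -> c = b.
Proof.
move=> [bS [nu nuE]] cS bc; apply/eqP/negPn/negP => cb.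
have : b \in SD nu.
  by apply: (SD_down (c := c)); [exact: SD_shifted bS | | rewrite nuE in_fsetD1 cb].
by rewrite nuE in_fsetD1 eqxx.
Qed.

Section DoubleSkew.
Variable GS : spart -> spart -> fps Zbeta nat.

Lemma coef_dskew lam mu m : psub mu lam ->
  dskew GS lam mu m = \sum_(nu <- sparts_upto (psize lam) | `[< removable_strip mu nu >])
    'X^#|` skewSD mu nu| * GS lam nu m.
Proof.
move=> ml; rewrite /dskew asboolT// /fps_sum [RHS]bigfs ?fset_uniq//; last first.
  move=> nu /asboolP[nm _]; rewrite mem_sparts_upto => /negP[].
  exact: leq_trans (leq_psize nm) (leq_psize ml).
rewrite (_ : [set` _] = [set nu | removable_strip mu nu]).
  by apply: eq_fsbigr => nu _; rewrite -rmorphXn coef_fps_constM.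
by apply/seteqP; split=> nu /=; rewrite unfold_in => /asboolP.
Qed.

Lemma dskew_supp lam mu m : dskew GS lam mu m != 0 ->
  psub mu lam /\ exists2 nu, psub nu mu & GS lam nu m != 0.
Proof.
have [ml|ml] := pselect (psub mu lam); last by rewrite /dskew asboolF// coef_fps0 eqxx.
move=> dskew_neq0; split=> //; apply: contrapT => GS0; move/negP: dskew_neq0; apply.
rewrite coef_dskew// big1// => nu /asboolP[nm _].
have [->|GSn0] := eqVneq (GS lam nu m) 0; first by rewrite mulr0.
by case: GS0; exists nu.
Qed.

End DoubleSkew.

End StrictPartitions.

(** * Tableaux as sets of cells *)

Notation cells := {fset box * nat}.

Definition boxes (F : cells) : {fset box} := [fset p.1 | p in F]%fset.

Definition increasing_along (u v : box -> nat) (repeatable : pred nat) (F : cells) : Prop :=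
  {in F &, forall p q, u p.1 = u q.1 -> (v p.1 < v q.1)%N ->
    (p.2 <= q.2)%N /\ (p.2 = q.2 -> repeatable p.2)}.

Definition semistandard (dg : bool) (F : cells) : Prop :=
  [/\ increasing_along fst snd (fun k => ~~ primed k) F,
      increasing_along snd fst primed F &
      dg -> {in F, forall p, p.1.1 = p.1.2 -> ~~ primed p.2}].

(* A tableau is encoded as the set of its pairs (box, entry); the flag dg forbids
   primed diagonal entries, so that it is set for GP and unset for GQ. *)
Definition is_tab (dg : bool) (lam mu : spart) (F : cells) : Prop :=
  boxes F = skewSD lam mu /\ semistandard dg F.

Definition weight (F : cells) : monom nat := seq_mset [seq p.2./2 | p <- F].

Section Cells.
Implicit Types (F A B : cells) (b c : box).

Lemma boxesP F b : reflect (exists k, (b, k) \in F) (b \in boxes F).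
Proof.
apply: (iffP (imfsetP _ _ _ _)) => [[[c k] kF ->]|[k kF]]; first by exists k.
by exists (b, k).
Qed.

Lemma mem_boxes F p : p \in F -> p.1 \in boxes F.
Proof. by case: p => b k kF; apply/boxesP; exists k. Qed.

Lemma boxesU A B : boxes (A `|` B)%fset = (boxes A `|` boxes B)%fset.
Proof. exact: imfsetU. Qed.

Lemma semistandardS dg F F' :
  (F `<=` F')%fset -> semistandard dg F' -> semistandard dg F.
Proof.
move=> /fsubsetP FF' [rows cols diag]; split=> [p q pF qF|p q pF qF|/diag diagF p pF].
- by apply: rows; exact: FF'.
- by apply: cols; exact: FF'.
- by apply: diagF; exact: FF'.
Qed.

Lemma size_weight F : size (weight F) = #|` F|.
Proof. by rewrite (perm_size (perm_eq_seq_mset _)) size_map. Qed.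

Lemma mem_weight F p : p \in F -> p.2./2 \in weight F.
Proof.
move=> pF; rewrite (perm_mem (perm_eq_seq_mset _)).
by apply/mapP; exists p.
Qed.

Lemma leq_card_tab dg lam mu F : is_tab dg lam mu F -> (#|` skewSD lam mu| <= #|` F|)%N.
Proof. by move=> [<- _]; exact: leq_imfset_card. Qed.

Section StraightTableau.
Variables (dg : bool) (lam : spart) (F : cells).
Hypothesis tabF : is_tab dg lam spart0 F.

Lemma straight_boxes : boxes F = SD lam.
Proof. by case: tabF; rewrite skewSD0. Qed.

Lemma straight_entry b c : shifted b -> box_le b c -> c \in boxes F -> exists k, (b, k) \in F.
Proof.
move=> bS bc; rewrite straight_boxes => cS; apply/boxesP; rewrite straight_boxes.
exact: SD_down cS.
Qed.

Lemma straight_shifted p : p \in F -> shifted p.1.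
Proof. by move=> /mem_boxes; rewrite straight_boxes; exact: SD_shifted. Qed.

Lemma straight_monotone :
  {in F &, forall p q, box_le p.1 q.1 -> p.1 != q.1 -> (p.2 <= q.2)%N}.
Proof.
move=> [[i j] k] [[i' j'] l] pF qF /andP[/= ii jj]; rewrite xpair_eqE /= => pq_ne.
have [_ [rows cols _]] := tabF.
have := straight_shifted pF; have := straight_shifted qF; rewrite /shifted /= => i'j' ij.
have [e eF] : exists e, (i, j', e) \in F.
  by apply: straight_entry (mem_boxes qF); rewrite /shifted /box_le /=; lia.
have [j_eq|lt_j] : j = j' \/ (j < j')%N by lia.
  by have [] := cols _ _ pF qF j_eq => //=; lia.
have [i_eq|lt_i] : i = i' \/ (i < i')%N by lia.
  by have [] := rows _ _ pF qF i_eq lt_j.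
have [] := rows _ _ pF eF erefl lt_j; have [] := cols _ _ eF qF erefl lt_i => /=; lia.
Qed.

(* If the diagonal boxes i and i + 1 had entries of the same absolute value a, the
   box (i, i + 1) would repeat a' in its row or a in its column. *)
Lemma straight_row_le p : p \in F -> (p.1.1 <= p.2./2.+1)%N.
Proof.
have [_ [rows cols _]] := tabF.
have diag_le i k : (i, i, k) \in F -> (i <= k./2.+1)%N.
  elim: i k => // -[//|i] IH k kF.
  have [e eF] : exists e, (i.+1, i.+1, e) \in F.
    by apply: straight_entry (mem_boxes kF); rewrite /shifted /box_le /=; lia.
  have [f fF] : exists f, (i.+1, i.+2, f) \in F.
    by apply: straight_entry (mem_boxes kF); rewrite /shifted /box_le /=; lia.
  have := IH _ eF; have [] := rows _ _ eF fF erefl (ltnSn _).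
  have [] := cols _ _ fF kF erefl (ltnSn _); rewrite /primed /=; lia.
case: p => -[i j] k pF; have := straight_shifted pF; rewrite /shifted /= => /andP[i0 ij].
have [e eF] : exists e, (i, i, e) \in F.
  by apply: straight_entry (mem_boxes pF); rewrite /shifted /box_le /=; lia.
have [j_eq|lt_j] : i = j \/ (i < j)%N by lia.
  by rewrite -j_eq in pF; exact: diag_le pF.
have := diag_le _ _ eF; have [] := rows _ _ eF pF erefl lt_j => /=; lia.
Qed.

End StraightTableau.
End Cells.

(** * Cutting a tableau *)

Section CutAtThreshold.
Variables (c : nat) (A B : cells).
Hypothesis A_lt : {in A, forall p, (p.2 < c)%N}.
Hypothesis B_ge : {in B, forall p, (c <= p.2)%N}.

Section Cut.
Variables (dg : bool) (lam : spart).
Hypothesis tabAB : is_tab dg lam spart0 (A `|` B)%fset.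

Let mem_A p : p \in A -> p \in (A `|` B)%fset.
Proof. by rewrite in_fsetU => ->. Qed.

Let mem_B p : p \in B -> p \in (A `|` B)%fset.
Proof. by rewrite in_fsetU orbC => ->. Qed.

Let entry_le b d k l : (b, k) \in (A `|` B)%fset -> (d, l) \in (A `|` B)%fset ->
  box_le b d -> b != d -> (k <= l)%N.
Proof. by move=> kF lF bd bd_ne; apply: (straight_monotone tabAB kF lF). Qed.

Lemma cut_lower_ideal : shifted_ideal (boxes A).
Proof.
split=> [b /boxesP[k /mem_A kF]|b d bS bd /boxesP[k kA]].
  exact: (straight_shifted tabAB kF).
have [->|bd_ne] := eqVneq b d; first by apply/boxesP; exists k.
have [l lF] := straight_entry tabAB bS bd (mem_boxes (mem_A kA)).
have := entry_le lF (mem_A kA) bd bd_ne; have /= := A_lt kA => kc lk.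
move: lF; rewrite in_fsetU => /orP[/mem_boxes //|/B_ge /=]; lia.
Qed.

Lemma cut_upper_ideal : shifted_ideal (SD lam `\` boxes B)%fset.
Proof.
split=> [b|b d bS bd]; rewrite !in_fsetD => /andP[dB dS]; first exact: SD_shifted dS.
rewrite (SD_down bS bd)// andbT; apply: contra dB => /boxesP[l lB].
have [->|bd_ne] := eqVneq d b; first by apply/boxesP; exists l.
have /boxesP[k kF] : d \in boxes (A `|` B)%fset by rewrite (straight_boxes tabAB).
have := entry_le (mem_B lB) kF bd; rewrite eq_sym => /(_ bd_ne).
have /= := B_ge lB => cl lk.
move: kF; rewrite in_fsetU => /orP[/A_lt /=|/mem_boxes //]; lia.
Qed.

Lemma cut_removable mu nu : SD mu = boxes A -> SD nu = (SD lam `\` boxes B)%fset ->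
  removable_strip mu nu.
Proof.
move=> muE nuE; have boxesE := straight_boxes tabAB; split.
  apply/psubP => b; rewrite nuE muE in_fsetD -boxesE boxesU in_fsetU.
  by case/andP => /negbTE ->; rewrite orbF.
move=> b; rewrite in_fsetD => /andP[bnu bmu]; split=> //.
have /boxesP[l lB] : b \in boxes B.
  by move: bnu; rewrite nuE in_fsetD negb_and negbK -boxesE boxesU in_fsetU -muE bmu orbF.
apply: exists_SD; split=> [d|d e dS de]; rewrite !in_fsetD1 => /andP[eb eS].
  exact: SD_shifted eS.
rewrite (SD_down dS de)// andbT; apply: contraNneq eb => db; rewrite db in de.
have /boxesP[k kA] : e \in boxes A by rewrite -muE.
apply/negPn/negP => be_ne; have := entry_le (mem_B lB) (mem_A kA) de.
rewrite eq_sym => /(_ be_ne); have /= := A_lt kA; have /= := B_ge lB; lia.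
Qed.

Lemma cut_tab : exists mu nu, [/\ psub mu lam, removable_strip mu nu,
  is_tab dg mu spart0 A & is_tab dg lam nu B].
Proof.
have [_ ssAB] := tabAB; have boxesE := straight_boxes tabAB.
have [mu muE] := exists_SD cut_lower_ideal; have [nu nuE] := exists_SD cut_upper_ideal.
exists mu, nu; split.
- by apply/psubP => b; rewrite muE -boxesE boxesU in_fsetU => ->.
- exact: cut_removable.
- by split; [rewrite skewSD0 | apply: semistandardS ssAB; exact: fsubsetUl].
- split; last by apply: semistandardS ssAB; exact: fsubsetUr.
  by rewrite /skewSD nuE fsetDK// -boxesE boxesU fsubsetUr.
Qed.

End Cut.

Lemma increasing_alongU u v repeatable :
  increasing_along u v repeatable A -> increasing_along u v repeatable B ->
  {in B & A, forall p q, u p.1 = u q.1 -> ~~ (v p.1 < v q.1)%N} ->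
  increasing_along u v repeatable (A `|` B)%fset.
Proof.
move=> incA incB apart p q; rewrite !in_fsetU => /orP[pA|pB] /orP[qA|qB] uE vlt.
- exact: incA.
- have lt := leq_trans (A_lt pA) (B_ge qB).
  by split=> [|pq_eq]; [exact: ltnW | rewrite pq_eq ltnn in lt].
- by have := apart p q pB qA uE; rewrite vlt.
- exact: incB.
Qed.

Lemma join_tab dg lam mu nu : psub mu lam -> removable_strip mu nu ->
  is_tab dg mu spart0 A -> is_tab dg lam nu B -> is_tab dg lam spart0 (A `|` B)%fset.
Proof.
move=> ml [nm strip] tabA [boxesB [rowsB colsB diagB]].
have [_ [rowsA colsA diagA]] := tabA; have boxesA := straight_boxes tabA.
have apart : {in B & A, forall p q, box_le p.1 q.1 -> p.1 = q.1}.
  move=> p q /mem_boxes + /mem_boxes qA pq.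
  rewrite boxesB in_fsetD => /andP[p_nu p_lam].
  have p_mu : p.1 \in boxes A.
    by rewrite boxesA; apply: SD_down (SD_shifted p_lam) pq _; rewrite -boxesA.
  apply/esym/(removable_max (mu := mu)) => //; last by rewrite -boxesA.
  by apply: strip; rewrite in_fsetD p_nu -boxesA.
split.
  rewrite skewSD0 boxesU boxesA boxesB; apply/fsetP => b; rewrite in_fsetU in_fsetD.
  apply/orP/idP => [[/((psubP mu lam).1 ml)//|/andP[]//]|b_lam].
  have [/((psubP nu mu).1 nm)|b_nu] := boolP (b \in SD nu); first by left.
  by right; rewrite b_lam.
split.
- apply: increasing_alongU => // p q pB qA rowE; apply/negP => lt.
  by move: (lt); rewrite (apart p q) ?ltnn// /box_le /= rowE leqnn ltnW.
- apply: increasing_alongU => // p q pB qA colE; apply/negP => lt.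
  by move: (lt); rewrite (apart p q) ?ltnn// /box_le /= colE leqnn ltnW.
- by move=> dgT p; rewrite in_fsetU => /orP[/(diagA dgT)|/(diagB dgT)].
Qed.

End CutAtThreshold.

Section Glue.
Variable n : nat.
Implicit Types (F : cells) (lam mu nu : spart).

Definition raise_cell (p : box * nat) : box * nat := (p.1, p.2 + n.*2)%N.

Definition raise F : cells := [fset raise_cell p | p in F]%fset.

Definition entries_lt F : Prop := {in F, forall p, (p.2 < n.*2)%N}.

Definition glue_cells F1 F2 : cells := (F1 `|` raise F2)%fset.

Lemma raise_cell_inj : injective raise_cell.
Proof. by move=> [b k] [b' k'] [-> /addIn ->]. Qed.

Lemma mem_raise F p : (p \in raise F) = (n.*2 <= p.2)%N && ((p.1, (p.2 - n.*2)%N) \in F).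
Proof.
apply/imfsetP/andP => [[[b k] kF ->]|[kn kF]] /=; first by rewrite leq_addl addnK.
by exists (p.1, (p.2 - n.*2)%N); rewrite // /raise_cell /= subnK -?surjective_pairing.
Qed.

Lemma raise_ge F : {in raise F, forall p, (n.*2 <= p.2)%N}.
Proof. by move=> p; rewrite mem_raise => /andP[]. Qed.

Lemma boxes_raise F : boxes (raise F) = boxes F.
Proof.
apply/fsetP => b; apply/boxesP/boxesP => -[k].
  by rewrite mem_raise => /andP[_]; exists (k - n.*2)%N.
by move=> kF; exists (k + n.*2)%N; rewrite mem_raise /= leq_addl addnK.
Qed.

Lemma primed_raise k : primed (k + n.*2)%N = primed k.
Proof. by rewrite /primed oddD odd_double addbF. Qed.

Lemma increasing_along_raise u v repeatable F :
  (forall k, repeatable (k + n.*2)%N = repeatable k) ->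
  increasing_along u v repeatable (raise F) <-> increasing_along u v repeatable F.
Proof.
move=> rep_raise; split=> inc p q.
  move=> pF qF uE vlt; have [] := inc (raise_cell p) (raise_cell q) _ _ uE vlt.
  - exact: in_imfset.
  - exact: in_imfset.
  - by rewrite leq_add2r rep_raise => le rep; split=> // pq_eq; apply: rep; rewrite /= pq_eq.
move=> /imfsetP[{}p pF ->] /imfsetP[{}q qF ->] uE vlt; have [le rep] := inc p q pF qF uE vlt.
by rewrite leq_add2r rep_raise; split=> // /addIn/rep.
Qed.

Lemma is_tab_raise dg lam mu F : is_tab dg lam mu (raise F) <-> is_tab dg lam mu F.
Proof.
rewrite /is_tab /semistandard boxes_raise.
have rows := @increasing_along_raise fst snd (fun k => ~~ primed k) F
  (fun k => congr1 negb (primed_raise k)).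
have cols := @increasing_along_raise snd fst primed F primed_raise.
split=> -[-> [/rows ? /cols ? diag]]; split=> //; split=> // dgT p pF.
  have := diag dgT (raise_cell p); rewrite primed_raise; apply.
  exact: in_imfset.
by case/imfsetP: pF => {}p pF ->; rewrite primed_raise; exact: (diag dgT p pF).
Qed.

Lemma is_tab_glue_cells dg lam F1 F2 : entries_lt F1 ->
  is_tab dg lam spart0 (glue_cells F1 F2) <->
  exists mu nu, [/\ psub mu lam, removable_strip mu nu,
    is_tab dg mu spart0 F1 & is_tab dg lam nu F2].
Proof.
move=> F1_lt; split=> [/(cut_tab F1_lt (@raise_ge F2))[mu [nu [ml strip tab1 tab2]]]|].
  by exists mu, nu; split=> //; apply/is_tab_raise.
move=> [mu [nu [ml strip tab1 tab2]]].
by apply: (join_tab F1_lt (@raise_ge F2) ml strip) => //; apply/is_tab_raise.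
Qed.

Lemma glue_cells_surj F : exists F1 F2, entries_lt F1 /\ F = glue_cells F1 F2.
Proof.
exists [fset p in F | (p.2 < n.*2)%N]%fset,
  [fset (p.1, (p.2 - n.*2)%N) | p in F & (n.*2 <= p.2)%N]%fset.
split=> [p|]; first by rewrite !inE => /andP[].
apply/fsetP => -[b k]; rewrite in_fsetU mem_raise !inE /=.
case: ltnP => kn; rewrite ?andbT ?andbF ?orbF //=.
apply/idP/imfsetP => [kF|[[b' k'] /=]]; first by exists (b, k); rewrite // !inE kF.
by rewrite !inE /= => /andP[k'F k'n] [-> k_eq]; have -> : k = k' by lia.
Qed.

Lemma glue_cells_inj F1 F2 F1' F2' : entries_lt F1 -> entries_lt F1' ->
  glue_cells F1 F2 = glue_cells F1' F2' -> F1 = F1' /\ F2 = F2'.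
Proof.
move=> F1_lt F1'_lt /fsetP glueE.
have low (A B : cells) (p : box * nat) : entries_lt A -> p \in A =
    (p \in glue_cells A B) && (p.2 < n.*2)%N.
  move=> A_lt; rewrite in_fsetU mem_raise; case: (boolP (p \in A)) => [/A_lt -> //|_] /=.
  by rewrite leqNgt andbAC andNb.
have high (A B : cells) (p : box * nat) : entries_lt A -> p \in B =
    (raise_cell p \in glue_cells A B).
  move=> A_lt; rewrite in_fsetU mem_raise /= leq_addl addnK -surjective_pairing.
  by case: (boolP (raise_cell p \in A)) => // /A_lt /=; rewrite ltnNge leq_addl.
split; apply/fsetP => p; first by rewrite (low F1 F2)// glueE -low.
by rewrite (high F1)// glueE -high.
Qed.

Lemma weight_glue_cells F1 F2 : entries_lt F1 ->
  weight (glue_cells F1 F2) = concat_monom n (weight F1) (weight F2).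
Proof.
move=> F1_lt; rewrite /weight /concat_monom mset_map_seq.
transitivity (seq_mset [seq p.2./2 | p <- F1 ++ [seq raise_cell p | p <- F2]]).
  apply/eq_seq_msetP/perm_map/uniq_perm => [||p]; first exact: fset_uniq.
    rewrite cat_uniq fset_uniq map_inj_uniq ?fset_uniq ?andbT//; last exact: raise_cell_inj.
    by apply/hasPn => _ /mapP[p _ ->]; apply/negP => /F1_lt /=; rewrite ltnNge leq_addl.
  rewrite mem_cat in_fsetU; congr (_ || _).
  by apply/imfsetP/mapP => -[q qF ->]; exists q.
apply/msetP => i; rewrite map_cat msetE2 !mset_seqE count_cat -!map_comp; congr addn.
by congr count; apply: eq_map => p /=; lia.
Qed.

End Glue.

(** * Coefficients as tableau counts *)

Definition SetShYT (dg : bool) (lam mu : spart) : set (filling lam mu) :=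
  if dg then @SetShYT_P lam mu else @SetShYT_Q lam mu.

Section CellsOfFilling.
Variables lam mu : spart.
Implicit Types (T : filling lam mu) (b c : skewSD lam mu).

Definition cell_seq T : seq (box * nat) :=
  [seq (val b, k) | b <- enum {: skewSD lam mu}, k <- enum_fset (T b)].

Definition cells_of T : cells := [fset p in cell_seq T]%fset.

Lemma cells_ofP T d k : reflect (exists2 b, d = val b & k \in T b) ((d, k) \in cells_of T).
Proof.
apply: (iffP idP) => [|[b -> kT]]; rewrite inE /=.
  by case/allpairsPdep => b [l [_ lT [-> ->]]]; exists b.
by apply/allpairsPdep; exists b, k; rewrite mem_enum.
Qed.

Lemma mem_cells_of T b k : ((val b, k) \in cells_of T) = (k \in T b).
Proof. by apply/cells_ofP/idP => [[b' /val_inj -> //]|]; exists b. Qed.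

Lemma cells_of_inj : injective cells_of.
Proof.
move=> T T' cells_eq; apply/ffunP => b; apply/fsetP => k.
by rewrite -!mem_cells_of cells_eq.
Qed.

Lemma cells_of_surj F : boxes F = skewSD lam mu -> exists T, cells_of T = F.
Proof.
move=> boxesF.
exists [ffun b : skewSD lam mu => [fset p.2 | p in F & p.1 == val b]%fset].
apply/fsetP => -[d k]; apply/cells_ofP/idP => [[b ->]|kF].
  by rewrite ffunE => /imfsetP[[c l] /=]; rewrite !inE /= => /andP[lF /eqP <-] ->.
have dS : d \in skewSD lam mu by rewrite -boxesF; apply/boxesP; exists k.
exists (FSetSub dS) => //; rewrite ffunE; apply/imfsetP; exists (d, k) => //.
by rewrite !inE kF /=.
Qed.

Lemma perm_cells_of T : perm_eq (cells_of T) (cell_seq T).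
Proof.
apply: uniq_perm => [||p]; [exact: fset_uniq| |by rewrite inE].
apply: allpairs_uniq_dep; first exact: enum_uniq.
  by move=> b _; exact: fset_uniq.
by move=> [b k] [b' k'] /= ? ? [/val_inj b_eq k_eq]; rewrite b_eq k_eq.
Qed.

Lemma coef_xmon T m : xmon T m = (m == weight (cells_of T))%:R.
Proof.
rewrite /weight; have /eq_seq_msetP -> := perm_map (fun p => p.2./2) (perm_cells_of T).
by rewrite -coef_prod_fps_var big_map /cell_seq big_allpairs_dep /xmon /= big_enum.
Qed.

Lemma tsize_cells_of T : Defs.tsize T = #|` cells_of T|.
Proof. by rewrite (perm_size (perm_cells_of T)) size_allpairs_dep sumnE big_map big_enum. Qed.

Lemma boxes_cells_of T : boxes (cells_of T) = skewSD lam mu <-> forall b, T b != fset0.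
Proof.
split=> [boxesT b|T_neq0].
  have /boxesP[k] : val b \in boxes (cells_of T) by rewrite boxesT; exact: valP.
  by rewrite mem_cells_of => kT; apply/fset0Pn; exists k.
apply/fsetP => d; apply/boxesP/idP => [[k /cells_ofP[b -> _]]|dS]; first exact: valP.
have /fset0Pn[k kT] := T_neq0 (FSetSub dS).
by exists k; apply/cells_ofP; exists (FSetSub dS).
Qed.

Lemma increasing_along_cells_of (u v : box -> nat) (repeatable : pred nat) T :
  (forall d e, u d = u e -> v d = v e -> d = e) ->
  increasing_along u v repeatable (cells_of T) <->
  (forall b c, u (val b) = u (val c) -> (v (val b) < v (val c))%N -> set_le (T b) (T c)) /\
  (forall b c k, b != c -> u (val b) = u (val c) -> k \in T b -> k \in T c -> repeatable k).
Proof.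
move=> uv_inj; split=> [incT|[le_T rep_T] [d k] [e l]].
  split=> [b c uE lt k l kT lT|b c k bc uE].
    by have [] := incT (val b, k) (val c, l) => //; rewrite mem_cells_of.
  rewrite -!mem_cells_of => kb kc; have [lt|gt|vE] := ltngtP (v (val b)) (v (val c)).
  - by have [_ /(_ erefl)] := incT _ _ kb kc uE lt.
  - by have [_ /(_ erefl)] := incT _ _ kc kb (esym uE) gt.
  - by move: bc; rewrite (val_inj (uv_inj _ _ uE vE)) eqxx.
move=> /cells_ofP[b -> kb] /cells_ofP[c -> lc] /= uE lt.
split=> [|kl]; first exact: le_T lt _ _ kb lc.
 apply: (rep_T b c) => //; last by rewrite kl.
by apply/eqP => bc; move: lt; rewrite bc ltnn.
Qed.

Lemma is_tab_cells_of dg T : is_tab dg lam mu (cells_of T) <-> SetShYT dg T.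
Proof.
have row_col_inj (d e : box) : d.1 = e.1 -> d.2 = e.2 -> d = e.
  by case: d e => [i j] [i' j'] /= -> ->.
have col_row_inj (d e : box) : d.2 = e.2 -> d.1 = e.1 -> d = e.
  by move=> col_eq row_eq; exact: row_col_inj.
have rowsE := @increasing_along_cells_of fst snd (fun k => ~~ primed k) T row_col_inj.
have colsE := @increasing_along_cells_of snd fst primed T col_row_inj.
have diagE : {in cells_of T, forall p, p.1.1 = p.1.2 -> ~~ primed p.2} <->
    forall b k, Defs.row b = Defs.col b -> k \in T b -> ~~ primed k.
  split=> [diag b k rc kT|diag [d k] /cells_ofP[b -> kT] rc]; last exact: diag rc kT.
  by apply: (diag (val b, k)); rewrite ?mem_cells_of.
have QE : SetShYT_Q T <-> [/\ boxes (cells_of T) = skewSD lam mu,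
    increasing_along fst snd (fun k => ~~ primed k) (cells_of T) &
    increasing_along snd fst primed (cells_of T)].
  split=> [[T0 rows cols colsP rowsP]|].
    by split; [exact/boxes_cells_of|apply/rowsE|apply/colsE].
  by move=> [/boxes_cells_of ? /rowsE[? ?] /colsE[? ?]]; split.
rewrite /is_tab /semistandard /SetShYT; case: dg; split.
- by move=> [? [? ? /(_ isT)/diagE ?]]; split=> //; apply/QE.
- by move=> [/QE[? ? ?] /diagE ?].
- by move=> [? [? ? _]]; apply/QE.
- by move=> /QE[? ? ?].
Qed.

Lemma cells_of_bij dg : set_bij (@SetShYT dg lam mu) [set F | is_tab dg lam mu F] cells_of.
Proof.
split=> [T /is_tab_cells_of //|T T' _ _|F tabF]; first exact: cells_of_inj.
have [T TF] := cells_of_surj tabF.1.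
by exists T => //; apply/is_tab_cells_of; rewrite TF.
Qed.

End CellsOfFilling.

Section Counting.
Variable dg : bool.
Implicit Types (lam mu nu : spart) (m : monom nat) (F : cells).

Definition Gskew lam mu : fps Zbeta nat := tableau_gf (@SetShYT dg lam mu).

Lemma finite_tabs lam mu m : finite_set [set F | is_tab dg lam mu F /\ weight F = m].
Proof.
pose entries := flatten [seq [:: i.*2; i.*2.+1] | i <- m].
pose U : cells := (skewSD lam mu `*` [fset k in entries])%fset.
apply: (@sub_finite_set _ _ [set` fpowerset U]); last exact: finite_fset.
move=> F /= [[boxesF _] Fm]; rewrite fpowersetE; apply/fsubsetP => p pF.
rewrite in_fsetM -boxesF mem_boxes// !inE; apply/flatten_mapP; exists p.2./2.
  by rewrite -Fm; exact: mem_weight.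
by rewrite !inE; lia.
Qed.

Definition tabs lam mu m : {fset cells} :=
  fset_set [set F | is_tab dg lam mu F /\ weight F = m].

Lemma tabsP lam mu m F : reflect (is_tab dg lam mu F /\ weight F = m) (F \in tabs lam mu m).
Proof.
rewrite in_fset_set; last exact: finite_tabs.
by apply: (iffP idP) => [/set_mem|?]; rewrite ?inE.
Qed.

Lemma coef_Gskew lam mu m : psub mu lam ->
  Gskew lam mu m = 'X^(size m - #|` skewSD lam mu|) *+ #|` tabs lam mu m|.
Proof.
move=> ml; rewrite /Gskew /tableau_gf asboolT// /fps_sum.
pose f F : Zbeta := 'X^(#|` F| - #|` skewSD lam mu|) * (m == weight F)%:R.
transitivity (\sum_(F \in [set F | is_tab dg lam mu F]) f F).
  rewrite (reindex_fsbig _ _ _ f (cells_of_bij lam mu dg)).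
  by apply: eq_fsbigr => T _; rewrite -rmorphXn coef_fps_constM coef_xmon tsize_cells_of.
rewrite -(@fsbig_widen _ _ _ _ [set F | is_tab dg lam mu F /\ weight F = m]); last 2 first.
- by move=> F /= [].
- by move=> F /= [tabF not_m]; rewrite /f; case: eqP => [mF|]; [case: not_m | rewrite mulr0].
rewrite fsbig_finite; last exact: finite_tabs.
rewrite -/(tabs lam mu m) big_seq (eq_bigr (fun=> 'X^(size m - #|` skewSD lam mu|))).
  by rewrite -big_seq big_const_seq count_predT iter_addr_0.
by move=> F /tabsP[_ Fm]; rewrite /f -Fm eqxx mulr1 size_weight.
Qed.

Lemma Gskew_supp lam mu m : Gskew lam mu m != 0 ->
  psub mu lam /\ exists2 F, is_tab dg lam mu F & weight F = m.
Proof.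
have [ml|ml] := pselect (psub mu lam); last first.
  by rewrite /Gskew /tableau_gf asboolF// coef_fps0 eqxx.
rewrite coef_Gskew// => coef_neq0; split=> //.
have /fset0Pn[F /tabsP[tabF Fm]] : tabs lam mu m != fset0.
  by apply: contraNneq coef_neq0 => ->; rewrite cardfs0.
by exists F.
Qed.

Lemma Gskew_degree lam mu m : Gskew lam mu m != 0 -> (psize lam <= size m + psize mu)%N.
Proof.
move=> /Gskew_supp[ml [F tabF <-]].
by rewrite -(card_skewSD ml) leq_add2r size_weight; exact: leq_card_tab tabF.
Qed.

End Counting.

(** * The coproduct *)

Section Coproduct.
Variables (dg : bool) (n : nat).
Implicit Types (lam mu nu : spart) (m : monom nat) (F : cells).
Local Notation tabs := (tabs dg).
Local Notation Gskew := (Gskew dg).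

Lemma entries_ltP F : entries_lt n F <-> all_lt n (weight F).
Proof.
rewrite /all_lt /weight (perm_all _ (perm_eq_seq_mset _)) all_map.
split=> [F_lt|/allP F_lt p /F_lt /=]; last by lia.
by apply/allP => p /F_lt /=; lia.
Qed.

Definition cut_shapes lam : seq (spart * spart) :=
  [seq s <- [seq (mu, nu) | mu <- enum_fset (sparts_upto (psize lam)),
                            nu <- enum_fset (sparts_upto (psize lam))]
  | `[< psub s.1 lam /\ removable_strip s.1 s.2 >]].

Lemma mem_cut_shapes lam mu nu :
  (mu, nu) \in cut_shapes lam <-> psub mu lam /\ removable_strip mu nu.
Proof.
rewrite mem_filter /=; split=> [/andP[/asboolP //]|s_mu_nu]; rewrite asboolT//=.
have [ml [nm _]] := s_mu_nu; apply/allpairsP; exists (mu, nu); rewrite !mem_sparts_upto.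
by split; rewrite //= leq_psize//; exact: psub_trans nm ml.
Qed.

Lemma cut_shapes_uniq lam : uniq (cut_shapes lam).
Proof.
apply/filter_uniq/allpairs_uniq; rewrite ?fset_uniq//.
by move=> [a b] [a' b'] _ _ [-> ->].
Qed.

Definition cuts lam m1 m2 : seq ((spart * spart) * (cells * cells)) :=
  [seq (s, f) | s <- cut_shapes lam,
     f <- [seq (F1, F2) | F1 <- enum_fset (tabs s.1 spart0 m1),
                          F2 <- enum_fset (tabs lam s.2 m2)]].

Lemma mem_cuts lam m1 m2 mu nu F1 F2 : ((mu, nu), (F1, F2)) \in cuts lam m1 m2 <->
  [/\ psub mu lam /\ removable_strip mu nu, is_tab dg mu spart0 F1 /\ weight F1 = m1 &
      is_tab dg lam nu F2 /\ weight F2 = m2].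
Proof.
split=> [/allpairsPdep[[mu' nu'] [[F1' F2'] [+ + [-> -> -> ->]]]]|[s_mu_nu tab1 tab2]].
  move=> /mem_cut_shapes ? /allpairsP[[F F'] [/= /tabsP ? /tabsP ? [-> ->]]].
  by split.
apply/allpairsPdep; exists (mu, nu), (F1, F2); split=> //; first exact/mem_cut_shapes.
by apply/allpairsP; exists (F1, F2); split=> //; exact/tabsP.
Qed.

Lemma cuts_uniq lam m1 m2 : uniq (cuts lam m1 m2).
Proof.
apply: allpairs_uniq_dep => [|s _|[s f] [s' f'] /= _ _ [-> ->] //].
  exact: cut_shapes_uniq.
by apply: allpairs_uniq; rewrite ?fset_uniq// => -[a b] [a' b'] _ _ [-> ->].
Qed.

Lemma size_cuts lam m1 m2 : size (cuts lam m1 m2) =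
  (\sum_(s <- cut_shapes lam) #|` tabs s.1 spart0 m1| * #|` tabs lam s.2 m2|)%N.
Proof.
rewrite size_allpairs_dep sumnE big_map; apply: eq_bigr => s _.
by rewrite size_allpairs.
Qed.

Lemma cuts_glue_inj lam m1 m2 : all_lt n m1 ->
  {in cuts lam m1 m2 &, injective (fun c => glue_cells n c.2.1 c.2.2)}.
Proof.
move=> m1_lt [[mu nu] [F1 F2]] [[mu' nu'] [F1' F2']].
move=> /mem_cuts[[ml [nm _]] [tab1 w1] [[boxes2 _] _]].
move=> /mem_cuts[[ml' [nm' _]] [tab1' w1'] [[boxes2' _] _]] /= glueE.
have [F1_eq F2_eq] : F1 = F1' /\ F2 = F2'.
  by apply: glue_cells_inj glueE; apply/entries_ltP; rewrite ?w1 ?w1'.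
subst F1' F2'; congr ((_, _), _).
  by apply: SD_inj; rewrite -(straight_boxes tab1) (straight_boxes tab1').
apply: (@skewSD_inj lam); rewrite -?boxes2 ?boxes2' //.
- exact: psub_trans nm ml.
- exact: psub_trans nm' ml'.
Qed.

Lemma card_tabs_coproduct lam m1 m2 : all_lt n m1 ->
  #|` tabs lam spart0 (concat_monom n m1 m2)| =
  (\sum_(s <- cut_shapes lam) #|` tabs s.1 spart0 m1| * #|` tabs lam s.2 m2|)%N.
Proof.
move=> m1_lt; rewrite -size_cuts -(size_map (fun c => glue_cells n c.2.1 c.2.2)).
apply/perm_size/uniq_perm => [||F]; first exact: fset_uniq.
  by rewrite map_inj_in_uniq ?cuts_uniq//; exact: cuts_glue_inj.
apply/tabsP/mapP => [[]|[[[mu nu] [F1 F2]] /mem_cuts[[ml strip] [tab1 w1] [tab2 w2]] ->]].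
  have [F1 [F2 [F1_lt ->]]] := glue_cells_surj n F; rewrite weight_glue_cells//.
  move=> /(is_tab_glue_cells _ _ _ F1_lt)[mu [nu [ml strip tab1 tab2]]].
  move=> /concat_monom_inj[|//|w1 w2]; first exact/entries_ltP.
  by exists ((mu, nu), (F1, F2)) => //; apply/mem_cuts.
have F1_lt : entries_lt n F1 by apply/entries_ltP; rewrite w1.
rewrite /= weight_glue_cells// w1 w2; split=> //.
by apply/is_tab_glue_cells => //; exists mu, nu.
Qed.

Lemma coef_Gskew_cut lam mu nu m1 m2 : psub mu lam -> removable_strip mu nu ->
  'X^(size m1 + size m2 - psize lam) *+ (#|` tabs mu spart0 m1| * #|` tabs lam nu m2|) =
  Gskew mu spart0 m1 * ('X^#|` skewSD mu nu| * Gskew lam nu m2).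
Proof.
move=> ml [nm _]; have nl := psub_trans nm ml.
rewrite !coef_Gskew//; last exact: psub0.
have [->|/fset0Pn[F1 /tabsP[tab1 w1]]] := eqVneq (tabs mu spart0 m1) fset0.
  by rewrite cardfs0 mul0n !mulr0n mul0r.
have [->|/fset0Pn[F2 /tabsP[tab2 w2]]] := eqVneq (tabs lam nu m2) fset0.
  by rewrite cardfs0 muln0 !mulr0n !mulr0.
have := leq_card_tab tab1; rewrite skewSD0 card_SD -size_weight w1 => le1.
have := leq_card_tab tab2; rewrite -size_weight w2 => le2.
rewrite !mulrnAr mulrnAl -mulrnA mulnC -!exprD; congr ('X^_ *+ (_ * _)).
have := card_skewSD nm; have := card_skewSD nl; lia.
Qed.

Lemma Gskew_coproduct lam m1 m2 : all_lt n m1 ->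
  Gskew lam spart0 (concat_monom n m1 m2) =
  \sum_(mu <- sparts_upto (psize lam)) Gskew mu spart0 m1 * dskew Gskew lam mu m2.
Proof.
move=> m1_lt; rewrite coef_Gskew; last exact: psub0.
rewrite (card_tabs_coproduct lam m2 m1_lt) -sumrMnr skewSD0 card_SD.
rewrite size_concat_monom big_filter big_mkcond big_allpairs; apply: eq_bigr => mu _.
have [ml|ml] := pselect (psub mu lam); last first.
  rewrite big1 => [|nu _]; last by rewrite asboolF// => -[].
  by rewrite /dskew asboolF// coef_fps0 mulr0.
rewrite coef_dskew// mulr_sumr [RHS]big_mkcond; apply: eq_bigr => nu _ /=.
have [strip|not_strip] := pselect (removable_strip mu nu).
  by rewrite !asboolT// coef_Gskew_cut.
by rewrite !asboolF// => -[].
Qed.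

End Coproduct.

(** * Linear independence *)

Section RowTails.
Implicit Types lam mu : spart.

Definition row_tail lam r : nat := (\sum_(b <- SD lam) (r < b.1))%N.

Definition row_rank lam : nat := (\sum_(b <- SD lam) b.1)%N.

Lemma part_sum lam i : part lam i.+1 = (\sum_(b <- SD lam) (b.1 == i.+1))%N.
Proof.
rewrite (sum_SD_rows lam (fun x => x == i.+1)); have [il|li] := ltnP i (size (parts lam)).
  rewrite (bigD1 (Ordinal il))//= eqxx muln1 big1 ?addn0// => j ji.
  by rewrite eqSS (negbTE ji : (j == i :> nat) = false) muln0.
rewrite part_eq0// big1// => j _.
by rewrite eqSS ltn_eqF ?muln0// (leq_trans (ltn_ord j) li).
Qed.

Lemma row_tailS lam r : row_tail lam r = (part lam r.+1 + row_tail lam r.+1)%N.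
Proof. by rewrite part_sum -big_split; apply: eq_bigr => b _ /=; lia. Qed.

Lemma row_tail_eq0 lam N r : {in SD lam, forall b, (b.1 < N)%N} -> (N <= r)%N ->
  row_tail lam r = 0%N.
Proof.
move=> lamN Nr; rewrite /row_tail big_seq big1// => b /lamN bN.
by rewrite ltnNge (leq_trans (ltnW bN) Nr).
Qed.

Lemma row_rank_tails lam N : {in SD lam, forall b, (b.1 < N)%N} ->
  row_rank lam = (\sum_(r < N) row_tail lam r)%N.
Proof.
move=> lamN; rewrite /row_tail exchange_big /row_rank big_seq [RHS]big_seq.
apply: eq_bigr => b /lamN bN /=.
by rewrite -{1}[b.1]card_ord -sum1_card (big_ord_widen N (fun=> 1%N)) ?(ltnW bN)// big_mkcond.
Qed.

Lemma row_tail_inj lam mu : row_tail lam =1 row_tail mu -> lam = mu.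
Proof.
move=> eq_tail; apply: spart_ext => -[//|r] _; apply/eqP.
by rewrite -(eqn_add2r (row_tail lam r.+1)) -row_tailS !eq_tail -row_tailS.
Qed.

Lemma row_rank_lt lam mu : (forall r, (row_tail lam r <= row_tail mu r)%N) ->
  (row_rank lam < row_rank mu)%N \/ lam = mu.
Proof.
move=> tail_le.
have [N /allP/= rowsN] := exists_all_lt [seq b.1 | b <- SD lam ++ SD mu].
have lamN : {in SD lam, forall b, (b.1 < N)%N}.
  by move=> b bS; apply: rowsN; rewrite map_f// mem_cat bS.
have muN : {in SD mu, forall b, (b.1 < N)%N}.
  by move=> b bS; apply: rowsN; rewrite map_f// mem_cat bS orbT.
have [rank_le rank_eq] := leqif_sum (fun (r : 'I_N) (_ : true) => leqif_eq (tail_le r)).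
rewrite (row_rank_tails lamN) (row_rank_tails muN) ltn_neqAle rank_eq rank_le andbT.
case: forallP => [eq_tail|_]; [right | by left].
apply: row_tail_inj => r; have [rN|Nr] := ltnP r N; first exact/eqP/(eq_tail (Ordinal rN)).
by rewrite (row_tail_eq0 lamN) ?(row_tail_eq0 muN).
Qed.

End RowTails.

Section RowTableau.
Implicit Types (lam mu : spart) (F : cells).

(* Row i holds the unprimed number i, whose code is 2 (i - 1) + 1. *)
Definition row_cell (b : box) : box * nat := (b, (b.1.-1).*2.+1).

Definition row_tab mu : cells := [fset row_cell b | b in SD mu]%fset.

Lemma row_cell_inj : injective row_cell.
Proof. by move=> b b' [-> _]. Qed.

Lemma is_tab_row_tab dg mu : is_tab dg mu spart0 (row_tab mu).
Proof.
have row_pos : {in SD mu, forall b, (0 < b.1)%N}.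
  by move=> b /SD_shifted/andP[].
split.
  rewrite skewSD0; apply/fsetP => b; apply/boxesP/idP => [[k /imfsetP[d dS [-> _]]] //|bS].
  by exists (b.1.-1).*2.+1; apply/imfsetP; exists b.
split=> [p q|p q|_ p] /imfsetP[[i j] /= bS ->].
- by move=> /imfsetP[[i' j'] /= dS ->] /= -> _; rewrite /primed; split; lia.
- move=> /imfsetP[[i' j'] /= dS ->] /= _ lt.
  have /= i_pos := row_pos _ bS; rewrite /primed; split; lia.
- by rewrite /primed /=; lia.
Qed.

Lemma sum_weight F (f : nat -> nat) :
  (\sum_(i <- weight F) f i = \sum_(p <- F) f p.2./2)%N.
Proof. by rewrite (perm_big _ (perm_eq_seq_mset _)) big_map. Qed.

Lemma sum_weight_row_tab mu (f : nat -> nat) :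
  (\sum_(i <- weight (row_tab mu)) f i.+1 = \sum_(b <- SD mu) f b.1)%N.
Proof.
rewrite (sum_weight _ (fun i => f i.+1)) big_imfset /=; last first.
  by move=> b b' _ _; exact: row_cell_inj.
rewrite big_seq [RHS]big_seq; apply: eq_bigr => b /SD_shifted; rewrite /shifted => bS.
by congr f; lia.
Qed.

Lemma size_weight_row_tab mu : size (weight (row_tab mu)) = psize mu.
Proof. by rewrite size_weight card_imfset ?card_SD//; exact: row_cell_inj. Qed.

Lemma leq_sum_boxes F (f : box -> nat) :
  (\sum_(b <- boxes F) f b <= \sum_(p <- F) f p.1)%N.
Proof.
rewrite [leqRHS](partition_big_imfset _ fst) -/(boxes F) big_seq [leqRHS]big_seq.
apply: leq_sum => b /boxesP[k kF].
by rewrite big_mkcond (bigD1_seq (b, k)) ?fset_uniq//= eqxx leq_addr.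
Qed.

Lemma row_tail_le dg lam mu F : is_tab dg lam spart0 F -> weight F = weight (row_tab mu) ->
  forall r, (row_tail lam r <= row_tail mu r)%N.
Proof.
move=> tabF weightF r; rewrite /row_tail -(sum_weight_row_tab mu (fun i => (r < i)%N)).
rewrite -weightF (sum_weight F (fun i => (r < i.+1)%N)) -(straight_boxes tabF).
apply: leq_trans (leq_sum_boxes F (fun b => (r < b.1)%N)) _.
rewrite big_seq [leqRHS]big_seq; apply: leq_sum => p /(straight_row_le tabF) row_le.
by case: ltnP => // /leq_trans/(_ row_le) ->.
Qed.

(* Triangularity: the monomial of the row tableau of mu occurs in G_lam only if, beyond
   every row, lam has at most as many boxes as mu. *)
Lemma Gskew_independent dg (C : spart -> Zbeta) :
  (forall m : monom nat, \sum_(mu <- sparts_upto (size m)) Gskew dg mu spart0 m * C mu = 0) ->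
  forall mu, C mu = 0.
Proof.
move=> sum0 mu; have [n] := ubnP (row_rank mu); elim: n mu => // n IH mu; rewrite ltnS.
move=> mu_n; move: (sum0 (weight (row_tab mu))).
rewrite (bigD1_seq mu) ?fset_uniq ?mem_sparts_upto ?size_weight_row_tab//=.
rewrite big1 ?addr0 => [/eqP|lam lam_mu].
  rewrite mulf_eq0 => /orP[|/eqP//]; rewrite coef_Gskew; last exact: psub0.
  rewrite -mulr_natr mulf_eq0 expf_eq0 polyX_eq0 andbF -polyC_natr polyC_eq0.
  rewrite Num.Theory.pnatr_eq0 cardfs_eq0 => /fset0Pn[]; exists (row_tab mu).
  by apply/tabsP; split=> //; exact: is_tab_row_tab.
have [->|/Gskew_supp[_ [F tabF Fm]]] := eqVneq (Gskew dg lam spart0 (weight (row_tab mu))) 0.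
  by rewrite mul0r.
have [lt|lamE] := row_rank_lt (row_tail_le tabF Fm); last by rewrite lamE eqxx in lam_mu.
by rewrite IH ?mulr0// (leq_trans lt).
Qed.

End RowTableau.

(** * The skew Cauchy identity *)

Section SkewCauchy.
Variables (GS : spart -> spart -> fps Zbeta nat) (g : spart -> fps Zbeta nat).
Variable c : spart -> spart -> spart -> int.
Implicit Types (lam mu nu kap : spart) (m k : monom nat).
Let G lam := GS lam spart0.
Let D := dskew GS.
Let gskew := dual_skew c g.
Let K m k := cauchy (xy_monom m k).

Hypothesis GS_degree : forall lam mu m,
  GS lam mu m != 0 -> (psize lam <= size m + psize mu)%N.
Hypothesis G_coproduct : forall n lam m1 m2, all_lt n m1 ->
  G lam (concat_monom n m1 m2) =
  \sum_(mu <- sparts_upto (psize lam)) G mu m1 * D lam mu m2.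
Hypothesis G_independent : forall C : spart -> Zbeta,
  (forall m, \sum_(mu <- sparts_upto (size m)) G mu m * C mu = 0) -> forall mu, C mu = 0.
Hypothesis G_dual : is_dual G g.
Hypothesis G_structure : is_structure_constants G c.

Let G_degree lam m : G lam m != 0 -> (psize lam <= size m)%N.
Proof. by move/GS_degree; rewrite addn0. Qed.

Let D_supp lam mu m : D lam mu m != 0 ->
  (psize mu <= psize lam <= size m + psize mu)%N.
Proof.
move=> /dskew_supp[ml [nu nm /GS_degree]].
have := leq_psize nm; have := leq_psize ml; lia.
Qed.

Let struct_coef lam mu nu : Zbeta := (c lam mu nu)%:~R * 'X^(psize lam - psize mu - psize nu).

Let coef_bcoefM lam mu nu f m : (bcoef c lam mu nu * f) m = struct_coef lam mu nu * f m.
Proof.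
by rewrite -(coef_fps_constM (struct_coef lam mu nu) f m) rmorphM rmorph_int rmorphXn.
Qed.

Let struct_coef_supp lam mu nu :
  struct_coef lam mu nu != 0 -> (psize mu + psize nu <= psize lam)%N.
Proof.
case: G_structure => c0 _; apply: contraNT; rewrite -ltnNge /struct_coef => /c0 ->.
by rewrite mul0r.
Qed.

Lemma coef_dual_skew N lam nu k : (psize lam <= N)%N ->
  gskew lam nu k = \sum_(kap <- sparts_upto N) struct_coef lam nu kap * g kap k.
Proof.
move=> lamN; rewrite /gskew /dual_skew /fps_sum (fsbig_sparts_upto (N := N)) => [|kap].
  by apply: eq_bigr => kap _; rewrite coef_bcoefM.
rewrite coef_bcoefM mulf_eq0 negb_or => /andP[/struct_coef_supp + _]; lia.
Qed.

Lemma sum_G_dual N m k : (size m <= N)%N ->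
  \sum_(lam <- sparts_upto N) G lam m * g lam k = K m k.
Proof.
move=> mN; case: G_dual => _ dualE; rewrite /K -dualE /fps_sum.
rewrite (fsbig_sparts_upto (N := N)) => [|lam].
  by apply: eq_bigr => lam _; rewrite coef_in_x_in_y.
rewrite coef_in_x_in_y mulf_eq0 negb_or => /andP[/G_degree + _]; lia.
Qed.

Lemma coef_G_mul N mu nu m : (size m <= N)%N ->
  (G mu * G nu) m = \sum_(lam <- sparts_upto N) struct_coef lam mu nu * G lam m.
Proof.
move=> mN; case: G_structure => _ /(_ mu nu)[_ ->].
rewrite /fps_sum (fsbig_sparts_upto (N := N)) => [|lam].
  by apply: eq_bigr => lam _; rewrite coef_bcoefM.
rewrite coef_bcoefM mulf_eq0 negb_or => /andP[_ /G_degree]; lia.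
Qed.

Lemma sum_G_dual_skew N nu m k : (size m <= N)%N ->
  \sum_(lam <- sparts_upto N) G lam m * gskew lam nu k =
  \sum_(p <- splits m) G nu p.1 * K p.2 k.
Proof.
move=> mN; transitivity (\sum_(kap <- sparts_upto N) (G nu * G kap) m * g kap k).
  transitivity (\sum_(lam <- sparts_upto N) \sum_(kap <- sparts_upto N)
      struct_coef lam nu kap * G lam m * g kap k).
    rewrite big_seq [RHS]big_seq; apply: eq_bigr => lam; rewrite mem_sparts_upto => lamN.
    rewrite (coef_dual_skew nu k lamN) mulr_sumr; apply: eq_bigr => kap _.
    by rewrite mulrCA mulrA.
  rewrite exchange_big; apply: eq_bigr => kap _ /=.
  by rewrite (coef_G_mul nu kap mN) mulr_suml.
under eq_bigr => kap _ do rewrite coef_fpsM_splits mulr_suml.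
rewrite exchange_big /= big_seq [RHS]big_seq; apply: eq_bigr => p.
rewrite mem_splits => /eqP pm.
rewrite -(sum_G_dual (N := N)) ?mulr_sumr; first by apply: eq_bigr => kap _; rewrite mulrA.
by apply: leq_trans mN; rewrite -pm size_msetD leq_addl.
Qed.

Let left_coef mu nu m k : Zbeta :=
  \sum_(lam <- sparts_upto (size m + psize mu)) D lam mu m * gskew lam nu k.

Let right_coef mu nu m k : Zbeta :=
  \sum_(kap <- sparts_upto (psize nu)) D nu kap m * gskew mu kap k.

Lemma sum_G_dual_skew_concat n nu m1 m2 k : all_lt n m1 ->
  \sum_(lam <- sparts_upto (size m1 + size m2))
    G lam (concat_monom n m1 m2) * gskew lam nu k =
  \sum_(mu <- sparts_upto (size m1)) G mu m1 * left_coef mu nu m2 k.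
Proof.
move=> m1_lt.
transitivity (\sum_(lam <- sparts_upto (size m1 + size m2)) \sum_(mu <- sparts_upto (size m1))
    G mu m1 * (D lam mu m2 * gskew lam nu k)).
  apply: eq_bigr => lam _; rewrite G_coproduct// mulr_suml.
  under eq_bigr do rewrite -mulrA.
  apply: sum_sparts_upto_widen => mu; rewrite !mulf_eq0 !negb_or.
  by move=> /and3P[/G_degree G_le /D_supp/andP[mu_lam _] _].
rewrite exchange_big /= big_seq [RHS]big_seq; apply: eq_bigr => mu.
rewrite mem_sparts_upto -mulr_sumr => mu_le; congr (_ * _).
apply: sum_sparts_upto_widen => lam.
rewrite mulf_eq0 negb_or => /andP[/D_supp/andP[_ lam_le] _]; split=> //.
by rewrite addnC; apply: leq_trans lam_le _; rewrite leq_add2l.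
Qed.

Lemma G_kernel_concat n nu m1 m2 k : all_lt n m1 ->
  \sum_(p <- splits (concat_monom n m1 m2)) G nu p.1 * K p.2 k =
  \sum_(p <- splits m1) \sum_(r <- splits m2)
    (\sum_(kap <- sparts_upto (psize nu)) G kap p.1 * D nu kap r.1) *
    (\sum_(q <- splits k) K p.2 q.1 * K r.2 q.2).
Proof.
move=> m1_lt; rewrite (sum_splits_concat _ (fun a b => G nu a * K b k))//.
rewrite big_seq [RHS]big_seq; apply: eq_bigr => p /(all_lt_splits m1_lt)[p1_lt p2_lt].
by apply: eq_bigr => r _; rewrite G_coproduct// /K coef_cauchy_concat.
Qed.

Lemma sum_G_right_coef nu m1 m2 k :
  \sum_(p <- splits m1) \sum_(r <- splits m2)
    (\sum_(kap <- sparts_upto (psize nu)) G kap p.1 * D nu kap r.1) *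
    (\sum_(q <- splits k) K p.2 q.1 * K r.2 q.2) =
  \sum_(mu <- sparts_upto (size m1)) G mu m1 *
    \sum_(r <- splits m2) \sum_(q <- splits k) right_coef mu nu r.1 q.1 * K r.2 q.2.
Proof.
transitivity (\sum_(r <- splits m2) \sum_(q <- splits k) \sum_(kap <- sparts_upto (psize nu))
   D nu kap r.1 * K r.2 q.2 * \sum_(p <- splits m1) G kap p.1 * K p.2 q.1).
  rewrite exchange_big; apply: eq_bigr => r _ /=.
  under eq_bigr do rewrite mulr_sumr.
  rewrite exchange_big; apply: eq_bigr => q _ /=.
  under eq_bigr do rewrite mulr_suml.
  rewrite exchange_big; apply: eq_bigr => kap _ /=; rewrite mulr_sumr.
  by apply: eq_bigr => p _; ring.
under [RHS]eq_bigr do rewrite mulr_sumr.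
rewrite [RHS]exchange_big; apply: eq_bigr => r _ /=.
under [RHS]eq_bigr do rewrite mulr_sumr.
rewrite [RHS]exchange_big; apply: eq_bigr => q _ /=.
under eq_bigr => kap _ do rewrite -(sum_G_dual_skew kap q.1 (leqnn _)) mulr_sumr.
rewrite exchange_big; apply: eq_bigr => mu _ /=.
by rewrite mulr_suml mulr_sumr; apply: eq_bigr => kap _; ring.
Qed.

Lemma skew_cauchy_coef mu nu m k : left_coef mu nu m k =
  \sum_(r <- splits m) \sum_(q <- splits k) right_coef mu nu r.1 q.1 * K r.2 q.2.
Proof.
apply/eqP; rewrite -subr_eq0; apply/eqP; move: mu; apply: G_independent => m1.
have [n m1_lt] := exists_all_lt m1; under eq_bigr do rewrite mulrBr.
rewrite sumrB -(sum_G_dual_skew_concat _ _ _ m1_lt) sum_G_dual_skew ?size_concat_monom//.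
by rewrite (G_kernel_concat _ _ _ m1_lt) sum_G_right_coef subrr.
Qed.

Lemma fps_summable_sparts (F : spart -> fps_xy) :
  (forall m k, exists N, forall lam, F lam (xy_monom m k) != 0 -> (psize lam <= N)%N) ->
  fps_summable [set: spart] F.
Proof.
move=> F_supp p; have [m [k ->]] := xy_monom_surj p; have [N F_supp_N] := F_supp m k.
apply: (@sub_finite_set _ _ [set lam | (psize lam <= N)%N]); last exact: finite_psize.
by move=> lam /= [_ /F_supp_N].
Qed.

Theorem skew_cauchy mu nu :
  [/\ fps_summable [set: spart] (fun lam => in_x (D lam mu) * in_y (gskew lam nu)),
      fps_summable [set: spart] (fun kap => in_x (D nu kap) * in_y (gskew mu kap)) &
      fps_sum [set: spart] (fun lam => in_x (D lam mu) * in_y (gskew lam nu)) =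
      cauchy * fps_sum [set: spart] (fun kap => in_x (D nu kap) * in_y (gskew mu kap))].
Proof.
have left_supp m k lam : (in_x (D lam mu) * in_y (gskew lam nu)) (xy_monom m k) != 0 ->
    (psize lam <= size m + psize mu)%N.
  by rewrite coef_in_x_in_y mulf_eq0 negb_or => /andP[/D_supp/andP[]].
have right_supp m k kap : (in_x (D nu kap) * in_y (gskew mu kap)) (xy_monom m k) != 0 ->
    (psize kap <= psize nu)%N.
  by rewrite coef_in_x_in_y mulf_eq0 negb_or => /andP[/D_supp/andP[]].
split.
- by apply: fps_summable_sparts => m k; exists (size m + psize mu)%N => lam /left_supp.
- by apply: fps_summable_sparts => m k; exists (psize nu) => lam /right_supp.
apply/funext => p; have [m [k ->]] := xy_monom_surj p.
rewrite mulrC coef_fpsM_splits (sum_splits_xy _ _ (fun a b => fps_sum _ _ a * cauchy b)).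
rewrite /fps_sum (fsbig_sparts_upto (N := size m + psize mu)); last by move=> lam /left_supp.
under eq_bigr do rewrite coef_in_x_in_y.
rewrite [LHS]skew_cauchy_coef; apply: eq_bigr => r _; apply: eq_bigr => q _.
rewrite (fsbig_sparts_upto (N := psize nu)); last by move=> kap /right_supp.
by congr (_ * _); apply: eq_bigr => kap _; rewrite coef_in_x_in_y.
Qed.

End SkewCauchy.

Theorem theorem6p10
    (gp gq : spart -> fps Zbeta nat) (a b : spart -> spart -> spart -> int)
    (Hgp : is_dual GQ gp) (Hgq : is_dual GP gq)
    (Ha : is_structure_constants GP a) (Hb : is_structure_constants GQ b)
    (mu nu : spart) :
  [/\ fps_summable [set: spart]
        (fun lam => in_x (GPdskew lam mu) * in_y (dual_skew a gq lam nu)),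
      fps_summable [set: spart]
        (fun kap => in_x (GPdskew nu kap) * in_y (dual_skew a gq mu kap)) &
      fps_sum [set: spart]
        (fun lam => in_x (GPdskew lam mu) * in_y (dual_skew a gq lam nu)) =
      cauchy * fps_sum [set: spart]
        (fun kap => in_x (GPdskew nu kap) * in_y (dual_skew a gq mu kap))] /\
  [/\ fps_summable [set: spart]
        (fun lam => in_x (GQdskew lam mu) * in_y (dual_skew b gp lam nu)),
      fps_summable [set: spart]
        (fun kap => in_x (GQdskew nu kap) * in_y (dual_skew b gp mu kap)) &
      fps_sum [set: spart]
        (fun lam => in_x (GQdskew lam mu) * in_y (dual_skew b gp lam nu)) =
      cauchy * fps_sum [set: spart]
        (fun kap => in_x (GQdskew nu kap) * in_y (dual_skew b gp mu kap))].
Proof.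
split.
- exact: (skew_cauchy (@Gskew_degree true) (@Gskew_coproduct true)
    (@Gskew_independent true) Hgq Ha).
- exact: (skew_cauchy (@Gskew_degree false) (@Gskew_coproduct false)
    (@Gskew_independent false) Hgp Hb).
Qed.
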